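(* Let $G$ be a Lie group with Lie algebra $\mathfrak g$ acting on smooth maps $F\colon M\to N$ and $F'\colon M'\to N'$, and let $\Phi=(\phi_N,\phi_M)\colon F'\to F$ be an equivariant map of pairs, with pullback $\Phi^*(\alpha,\beta)=(\phi_N^*\alpha,\phi_M^*\beta)$. (i) $\Phi^*$ is a cochain map: $d_{F'}\circ\Phi^*=\Phi^*\circ d_F$; and for every $x\in\mathfrak g$, $\Phi^*\circ\iota_{v_x}=\iota_{v_x}\circ\Phi^*$ and $\Phi^*\circ\mathcal L_{v_x}=\mathcal L_{v_x}\circ\Phi^*$ (where $v_x$ denotes the fundamental $F$-pair, respectively $F'$-pair). (ii) $\Phi^*$ induces cochain maps $C_{\mathfrak g}(F)\to C_{\mathfrak g}(F')$ of relative Chevalley–Eilenberg–de Rham complexes and $C_G(F)\to C_G(F')$ of relative Cartan models, sending extensions of a $G$-invariant relative pre-$n$-plectic structure $\varpi\in\Omega^{n+1}(F)$ to extensions of $\Phi^*\varpi$. (iii) If $\varpi-\mathrm M$ is a one-step extension for $(F,\varpi)$, then $\Phi^*\varpi-\Phi^*\mathrm M$ is one for $(F',\Phi^*\varpi)$, and the induced relative homotopy moment maps $$f_k(x_1,\dots,x_k)=\varsigma(k)\,\iota(v_{x_1}\wedge\dots\wedge v_{x_{k-1}})\mathrm M(x_k),\quad f_k'(x_1,\dots,x_k)=\varsigma(k)\,\iota(v_{x_1}\wedge\dots\wedge v_{x_{k-1}})\Phi^*\mathrm M(x_k)\qquad(1\le k\le n)$$ correspond under $\Phi^*$: $f_k'=\Phi^*\circ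 f_k$.
   Context: All manifolds, maps, forms and actions are smooth. $\varsigma(k):=-(-1)^{k(k+1)/2}$. A map of pairs $\Phi=(\phi_N,\phi_M)\colon F'\to F$ consists of smooth maps $\phi_N\colon N'\to N$, $\phi_M\colon M'\to M$ with $F\circ\phi_M=\phi_N\circ F'$; it is equivariant if $\phi_N,\phi_M$ are $G$-equivariant. $\Omega^k(F)=\Omega^k(N)\oplus\Omega^{k-1}(M)$ (forms of negative degree are $0$), $d_F(\alpha,\beta)=(d\alpha,F^*\alpha-d\beta)$. An $F$-pair is a pair $v=(v_N,v_M)$ of vector fields on $N$ and $M$ with $TF\circ v_M=v_N\circ F$; $\iota_v(\alpha,\beta)=(\iota_{v_N}\alpha,-\iota_{v_M}\beta)$, $\mathcal L_v(\alpha,\beta)=(\mathcal L_{v_N}\alpha,\mathcal L_{v_M}\beta)$; $\iota(v_1\wedge\dots\wedge v_k)=\iota_{v_k}\cdots\iota_{v_1}$. A relative pre-$n$-plectic structure ($n\ge1$) is $\varpi\in\Omega^{n+1}(F)$ with $d_F\varpi=0$. An action of $G$ on $F$ is a pair of left actions on $M$ and $N$ making $F$ equivariant; $v_x|_p=\frac{d}{dt}|_{t=0}\exp(-tx)\cdot p$, and the fundamental $F$-pair is $v_x=(v_x^N,v_x^M)$. Relative Chevalley–Eilenberg–de Rham complex: $C_{\mathfrak g}^{p,q}(P)=\Lambda^p\mathfrak g^\vee\otimes\Omega^q(P)$, $\mathbf d=\delta_{\mathrm{CE}}+(-1)^pd$ with $(\delta_{\mathrm{CE}}c)(x_1,\dots,x_{k+1})=\sum_{i<j}(-1)^{i+j}c([x_i,x_j],x_1,\dots,\widehat{x_i},\dots,\widehat{x_j},\dots,x_{k+1})$;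 $C_{\mathfrak g}(F)^k=C_{\mathfrak g}^k(N)\oplus C_{\mathfrak g}^{k-1}(M)$ (total degrees), $\mathbf d_F(a,b)=(\mathbf da,F^*a-\mathbf db)$. Relative Cartan model: $C_G^k(P)=\bigoplus_{2p+q=k}(S^p\mathfrak g^\vee\otimes\Omega^q(P))^G$, $(d_G\alpha)(x)=d(\alpha(x))-\iota_{v_x}(\alpha(x))$; $C_G(F)^k=C_G^k(N)\oplus C_G^{k-1}(M)$, $d_G^F(\alpha,\beta)=(d_G\alpha,F^*\alpha-d_G\beta)$. An extension of a $G$-invariant relative pre-$n$-plectic $\varpi$ is a $d_G^F$-cocycle $\varpi_G=\varpi-\sum_{i\ge1}\mathrm P_i\in C_G(F)^{n+1}$ with $\mathrm P_i\in(S^i\mathfrak g^\vee\otimes\Omega^{n+1-2i}(F))^G$; it is one-step if $\mathrm P_i=0$ for $i\ge2$ (then $\mathrm M=\mathrm P_1$). A one-step extension induces a relative homotopy moment map by the formula in (iii), where a relative homotopy moment map is an $L_\infty$-morphism from $\mathfrak g$ to the Lie $n$-algebra of relative observables lifting the action, concretely a collection of linear maps $f_k\colon\Lambda^k\mathfrak g\to\Omega^{n-k}(F)$, $1\le k\le n$, with ($f_0=f_{n+1}=0$) for $1\le k\le n+1$: $\sum_{i<j}(-1)^{i+j+1}f_{k-1}([x_i,x_j],x_1,\dots,\widehat{x_i},\dots,\widehat{x_j},\dots,x_k)=d_Ff_k(x_1,\dots,x_k)+\varsigma(k)\iota(v_{x_1}\wedge\dots\wedge v_{x_k})\varpi$.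 *)

(* Defs.v *)
From HB Require Import structures.
From mathcomp Require Export all_boot all_order all_algebra.
From mathcomp Require Export all_classical all_reals all_analysis.
Export numFieldNormedType.Exports.
Export Order.TTheory GRing.Theory Num.Theory.
Set Implicit Arguments.
Unset Strict Implicit.
Unset Printing Implicit Defensive.
Global Open Scope classical_set_scope.
Global Open Scope ring_scope.

(** ** Smooth manifolds *)

(* Only used for open U; then [forall k, cont_diff k U f] says that f is
   C^oo on U when V is finite dimensional. *)
Fixpoint cont_diff (R : realType) (k : nat) (V W : normedModType R)
    (U : set V) (f : V -> W) : Prop :=
  (forall x, U x -> {for x, continuous f}) /\
  (if k is k'.+1 then
     (forall x, U x -> differentiable f x) /\
     (forall v, cont_diff k' U (fun x => 'D_v f x))
   else True).

Definition smooth_on (R : realType) (V W : normedModType R)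
  (U : set V) (f : V -> W) := forall k, cont_diff k U f.

(* [chart_map] and [chart_inv] are total; their values outside [chart_dom],
   respectively outside its image, are junk. *)
Record chart (R : realType) (T : topologicalType) (m : nat) := Chart {
  chart_dom : set T ;
  chart_map :> T -> 'rV[R]_m ;
  chart_inv : 'rV[R]_m -> T ;
  chart_open : open chart_dom ;
  chart_open_im : open (chart_map @` chart_dom) ;
  chart_cont : forall p, chart_dom p -> {for p, continuous chart_map} ;
  chart_inv_cont : forall u, (chart_map @` chart_dom) u ->
    {for u, continuous chart_inv} ;
  chart_mapK : forall p, chart_dom p -> chart_inv (chart_map p) = p }.

Definition chart_im (R : realType) (T : topologicalType) (m : nat)
  (c : chart R T m) : set 'rV[R]_m := c @` chart_dom c.

(* The tangent space at p is represented as R^dim by means of the preferred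
   chart [chart_at p]: a row vector u stands for the tangent vector whose
   coordinates in that chart are u. *)
Record manifold (R : realType) := Manifold {
  carrier :> topologicalType ;
  dim : nat ;
  atlas : set (chart R carrier dim) ;
  chart_at : carrier -> chart R carrier dim ;
  manifold_hausdorff : hausdorff_space carrier ;
  manifold_second_countable : @second_countable carrier ;
  chart_at_atlas : forall p, atlas (chart_at p) ;
  chart_at_dom : forall p, chart_dom (chart_at p) p ;
  atlas_compatible : forall c c', atlas c -> atlas c' ->
    smooth_on (c @` (chart_dom c `&` chart_dom c')) (c' \o chart_inv c) }.

Definition tangent (R : realType) (M : manifold R) := 'rV[R]_(dim M).

Definition smooth (R : realType) (M N : manifold R) (f : M -> N) :=
  continuous f /\
  forall c c', atlas c -> atlas c' ->
    smooth_on (c @` (chart_dom c `&` f @^-1` chart_dom c'))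
      (c' \o f \o chart_inv c).

(* Smoothness of f as a map A x B -> C, in the product charts of A x B. *)
Definition smooth2 (R : realType) (A B C : manifold R) (f : A -> B -> C) :=
  continuous (fun z : A * B => f z.1 z.2) /\
  forall (a : chart R A (dim A)) (b : chart R B (dim B))
         (c : chart R C (dim C)), atlas a -> atlas b -> atlas c ->
    smooth_on
      [set w : 'rV[R]_(dim A) * 'rV[R]_(dim B) |
        [/\ chart_im a w.1, chart_im b w.2
          & chart_dom c (f (chart_inv a w.1) (chart_inv b w.2))]]
      (fun w => c (f (chart_inv a w.1) (chart_inv b w.2))).

Definition smooth_curve (R : realType) (M : manifold R) (gam : R^o -> M) :=
  continuous gam /\
  forall c, atlas c -> smooth_on (gam @^-1` chart_dom c) (c \o gam).

Definition velocity (R : realType) (M : manifold R) (gam : R^o -> M) (t : R^o)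
  : tangent M := 'D_1 (chart_at (gam t) \o gam) t.

Definition tangent_map (R : realType) (M N : manifold R) (f : M -> N) (p : M)
    (u : tangent M) : tangent N :=
  'D_u (chart_at (f p) \o f \o chart_inv (chart_at p)) (chart_at p p).

Definition vfield (R : realType) (M : manifold R) := M -> tangent M.

(* Coordinate expression of X in the chart c. *)
Definition vfield_in (R : realType) (M : manifold R)
    (c : chart R M (dim M)) (X : vfield M) (u : 'rV[R]_(dim M))
    : 'rV[R]_(dim M) :=
  let q := chart_inv c u in
  'D_(X q) (c \o chart_inv (chart_at q)) (chart_at q q).

Definition vfield_bracket (R : realType) (M : manifold R) (X Y : vfield M)
    : vfield M := fun p =>
  'D_(X p) (vfield_in (chart_at p) Y) (chart_at p p)
  - 'D_(Y p) (vfield_in (chart_at p) X) (chart_at p p).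

(** ** Differential forms *)

(* Alternating multilinear maps of all arities at once: the restriction of f
   to lists of length k is an alternating k-linear map. *)
Definition alt_multilinear (R : realType) (V W : lmodType R)
    (f : seq V -> W) :=
  (forall s1 s2 a u w,
     f (s1 ++ (a *: u + w) :: s2) = a *: f (s1 ++ u :: s2) + f (s1 ++ w :: s2))
  /\ (forall s1 s2 s3 u, f (s1 ++ u :: s2 ++ u :: s3) = 0).

(* A (possibly inhomogeneous) form is evaluated at a point on a list of tangent
   vectors; its component of degree k is its restriction to lists of length k.
   The operations below are defined on this ambient module, and the actual
   space of smooth k-forms is the subset [Omega k]. *)
Definition dform (R : realType) (M : manifold R) := M -> seq (tangent M) -> R^o.

(* The pullback of w by the inverse of the chart c. *)
Definition form_in (R : realType) (M : manifold R) (c : chart R M (dim M))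
    (w : dform M) (u : 'rV[R]_(dim M)) (s : seq 'rV[R]_(dim M)) : R^o :=
  let q := chart_inv c u in
  w q [seq 'D_e (chart_at q \o chart_inv c) u | e : 'rV[R]_(dim M) <- s].

Definition Omega (R : realType) (M : manifold R) (k : nat) : set (dform M) :=
  [set w | [/\ forall p s, size s <> k -> w p s = 0,
               forall p, alt_multilinear (w p)
             & forall c s, atlas c ->
                 smooth_on (chart_im c) (fun u => form_in c w u s)]].

Definition rem_at (T : Type) (i : nat) (s : seq T) := take i s ++ drop i.+1 s.

(* dw(e_0, .., e_k) = \sum_i (-1)^i e_i(w(e_0, .., ^e_i, .., e_k)) for the
   coordinate (commuting) constant vector fields of the preferred chart. *)
Definition ext_d (R : realType) (M : manifold R) (w : dform M) : dform M :=
  fun p s => \sum_(i < size s)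
    (-1) ^+ i * 'D_(nth 0 s i)
      (fun u => form_in (chart_at p) w u (rem_at i s)) (chart_at p p).

Definition contract (R : realType) (M : manifold R) (X : vfield M)
    (w : dform M) : dform M := fun p s => w p (X p :: s).

(* (L_X w)(e_1, .., e_k) = X(w(e_1, .., e_k)) - \sum_i w(.., [X, e_i], ..)
   for constant e_i in the preferred chart, where [X, e_i] = - D_(e_i) X. *)
Definition lie_der (R : realType) (M : manifold R) (X : vfield M)
    (w : dform M) : dform M :=
  fun p s =>
    'D_(X p) (fun u => form_in (chart_at p) w u s) (chart_at p p)
    + \sum_(i < size s) w p (set_nth 0 s i
        ('D_(nth 0 s i) (vfield_in (chart_at p) X) (chart_at p p))).

Definition pull (R : realType) (M N : manifold R) (f : M -> N) (w : dform N)
    : dform M :=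
  fun p s => w (f p) [seq tangent_map f p u | u <- s].

(** ** Lie groups and actions *)

Record lieGroup (R : realType) := LieGroup {
  lg_manifold :> manifold R ;
  lg_one : lg_manifold ;
  lg_mul : lg_manifold -> lg_manifold -> lg_manifold ;
  lg_inv : lg_manifold -> lg_manifold ;
  lg_mulA : associative lg_mul ;
  lg_mul1 : left_id lg_one lg_mul ;
  lg_mulV : left_inverse lg_one lg_inv lg_mul ;
  lg_mul_smooth : smooth2 lg_mul ;
  lg_inv_smooth : smooth lg_inv }.

Definition lieAlg (R : realType) (G : lieGroup R) : lmodType R :=
  'rV[R]_(dim G).

Definition left_invariant (R : realType) (G : lieGroup R) (x : lieAlg G)
  : vfield G := fun g => tangent_map (lg_mul g) (lg_one G) x.

Definition lie_bracket (R : realType) (G : lieGroup R) (x y : lieAlg G)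
    : lieAlg G :=
  vfield_bracket (left_invariant x) (left_invariant y) (lg_one G).

Definition Ad (R : realType) (G : lieGroup R) (g : G) (x : lieAlg G)
    : lieAlg G :=
  tangent_map (fun h => lg_mul (lg_mul g h) (lg_inv g)) (lg_one G) x.

(* t |-> exp(t x): the one-parameter subgroup with initial velocity x, which
   exists and is unique by the theory of ODEs (the default value of [xget] is
   never used). *)
Definition exp_curve (R : realType) (G : lieGroup R) (x : lieAlg G)
    : R^o -> G :=
  xget (fun _ : R^o => lg_one G)
    [set gam : R^o -> G | [/\ smooth_curve gam,
       forall s t, gam (s + t) = lg_mul (gam s) (gam t)
     & velocity gam 0 = x]].

Record lie_action (R : realType) (G : lieGroup R) (M : manifold R) :=
    LieAction {
  act :> G -> M -> M ;
  act1 : forall p, act (lg_one G) p = p ;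
  actM : forall g h p, act (lg_mul g h) p = act g (act h p) ;
  act_smooth : smooth2 act }.

Definition equivariant (R : realType) (G : lieGroup R) (M N : manifold R)
    (aM : lie_action G M) (aN : lie_action G N) (f : M -> N) :=
  forall g p, f (aM g p) = aN g (f p).

Definition fund (R : realType) (G : lieGroup R) (M : manifold R)
    (a : lie_action G M) (x : lieAlg G) : vfield M :=
  fun p => velocity (fun t : R^o => a (exp_curve x (- t)) p) 0.

(** ** Cochain maps and relative (mapping cone) complexes *)

Definition cone_deg (A B : zmodType) (A_ : nat -> set A) (B_ : nat -> set B)
    (k : nat) : set (A * B) :=
  [set ab | A_ k ab.1 /\ (if k is k'.+1 then B_ k' ab.2 else ab.2 = 0)].

Definition cone_d (A B : zmodType) (dA : A -> A) (dB : B -> B) (Fs : A -> B)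
    (ab : A * B) : A * B := (dA ab.1, Fs ab.1 - dB ab.2).

(* Morphism from the graded subspace A_ of V with differential dV to the
   graded subspace B_ of W with differential dW. *)
Definition cochain_map (R : realType) (V W : lmodType R)
    (A_ : nat -> set V) (dV : V -> V) (B_ : nat -> set W) (dW : W -> W)
    (f : V -> W) :=
  forall k, [/\ forall u, A_ k u -> B_ k (f u),
    forall a u v, A_ k u -> A_ k v -> f (a *: u + v) = a *: f u + f v
  & forall u, A_ k u -> dW (f u) = f (dV u)].

(** ** Relative forms *)

Definition rform (R : realType) (N M : manifold R) : lmodType R :=
  (dform N * dform M)%type.

Definition rOmega (R : realType) (N M : manifold R) : nat -> set (rform N M) :=
  cone_deg (@Omega R N) (@Omega R M).

Definition rext_d (R : realType) (N M : manifold R) (F : M -> N)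
    : rform N M -> rform N M :=
  cone_d (@ext_d R N) (@ext_d R M) (pull F).

Definition rpull (R : realType) (N M N' M' : manifold R)
    (phiN : N' -> N) (phiM : M' -> M) (w : rform N M) : rform N' M' :=
  (pull phiN w.1, pull phiM w.2).

Definition rcontract (R : realType) (N M : manifold R)
    (v : vfield N * vfield M) (w : rform N M) : rform N M :=
  (contract v.1 w.1, - contract v.2 w.2).

Definition rlie_der (R : realType) (N M : manifold R)
    (v : vfield N * vfield M) (w : rform N M) : rform N M :=
  (lie_der v.1 w.1, lie_der v.2 w.2).

Definition rfund (R : realType) (G : lieGroup R) (N M : manifold R)
    (aN : lie_action G N) (aM : lie_action G M) (x : lieAlg G)
    : vfield N * vfield M := (fund aN x, fund aM x).

(* iota(v_(x_1) /\ .. /\ v_(x_k)) = iota_(v_(x_k)) .. iota_(v_(x_1)) *)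
Definition rcontracts (R : realType) (G : lieGroup R) (N M : manifold R)
    (aN : lie_action G N) (aM : lie_action G M) (xs : seq (lieAlg G))
    (w : rform N M) : rform N M :=
  foldl (fun w' x => rcontract (rfund aN aM x) w') w xs.

Definition pre_plectic (R : realType) (N M : manifold R) (F : M -> N)
    (n : nat) (w : rform N M) := rOmega n.+1 w /\ rext_d F w = 0.

Definition rinvariant (R : realType) (G : lieGroup R) (N M : manifold R)
    (aN : lie_action G N) (aM : lie_action G M) (w : rform N M) :=
  forall g, rpull (aN g) (aM g) w = w.

(* Pullback of form-valued cochains, on values. *)
Definition val_pull (R : realType) (X : Type) (M N : manifold R) (f : M -> N)
    (c : X -> dform N) : X -> dform M := fun x => pull f (c x).

Definition rval_pull (R : realType) (X : Type) (N M N' M' : manifold R)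
    (phiN : N' -> N) (phiM : M' -> M)
    (c : (X -> dform N) * (X -> dform M)) :
    (X -> dform N') * (X -> dform M') :=
  (val_pull phiN c.1, val_pull phiM c.2).

(** ** Relative Chevalley-Eilenberg-de Rham complex *)

(* With 0-based positions i < j the parity of i + j is the same as with
   1-based ones. *)
Definition delta_CE (R : realType) (G : lieGroup R) (W : lmodType R)
    (c : seq (lieAlg G) -> W) (xs : seq (lieAlg G)) : W :=
  \sum_(j < size xs) \sum_(i < size xs | (i < j)%N)
    (-1) ^+ (i + j) *:
      c (lie_bracket (nth 0 xs i) (nth 0 xs j) :: rem_at i (rem_at j xs)).

Definition CE_cochain (R : realType) (G : lieGroup R) (P : manifold R) :
  lmodType R := seq (lieAlg G) -> dform P.

(* The sum over p + q = k of the spaces of alternating p-linear maps from the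
   Lie algebra to q-forms. *)
Definition CE_deg (R : realType) (G : lieGroup R) (P : manifold R) (k : nat)
    : set (CE_cochain G P) :=
  [set c | alt_multilinear c /\
    forall xs, if (size xs <= k)%N then Omega (k - size xs) (c xs)
               else c xs = 0].

Definition CE_d (R : realType) (G : lieGroup R) (P : manifold R)
    (c : CE_cochain G P) : CE_cochain G P :=
  fun xs => delta_CE c xs + (-1) ^+ size xs *: (ext_d (c xs) : dform P).

Definition rCE_cochain (R : realType) (G : lieGroup R) (N M : manifold R) :
  lmodType R := (CE_cochain G N * CE_cochain G M)%type.

Definition rCE_deg (R : realType) (G : lieGroup R) (N M : manifold R) :
    nat -> set (rCE_cochain G N M) :=
  cone_deg (@CE_deg R G N) (@CE_deg R G M).

Definition rCE_d (R : realType) (G : lieGroup R) (N M : manifold R)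
    (F : M -> N) : rCE_cochain G N M -> rCE_cochain G N M :=
  cone_d (@CE_d R G N) (@CE_d R G M) (val_pull F).

(** ** Relative Cartan model *)

Definition cartan_cochain (R : realType) (G : lieGroup R) (P : manifold R) :
  lmodType R := lieAlg G -> dform P.

(* S^p(g^vee) (x) Omega^q(P), as homogeneous polynomial maps of degree p in the
   coordinates of x. *)
Definition poly_form (R : realType) (G : lieGroup R) (P : manifold R)
    (p q : nat) : set (cartan_cochain G P) :=
  [set alpha | exists c : {ffun 'I_p -> 'I_(dim G)} -> dform P,
     (forall m, Omega q (c m)) /\
     forall x : 'rV[R]_(dim G),
       alpha x = \sum_(m : {ffun 'I_p -> 'I_(dim G)})
                   (\prod_(j < p) x 0 (m j)) *: (c m : dform P)].

(* (S^p(g^vee) (x) Omega^q(P))^G *)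
Definition inv_poly_form (R : realType) (G : lieGroup R) (P : manifold R)
    (a : lie_action G P) (p q : nat) : set (cartan_cochain G P) :=
  [set alpha | poly_form p q alpha /\
     forall g x, pull (a (lg_inv g)) (alpha (Ad (lg_inv g) x)) = alpha x].

Definition cartan_deg (R : realType) (G : lieGroup R) (P : manifold R)
    (a : lie_action G P) (k : nat) : set (cartan_cochain G P) :=
  [set alpha | exists c : nat -> cartan_cochain G P,
     (forall p, (2 * p <= k)%N -> inv_poly_form a p (k - 2 * p) (c p)) /\
     alpha = \sum_(p < k.+1 | (2 * p <= k)%N) c p].

Definition cartan_d (R : realType) (G : lieGroup R) (P : manifold R)
    (a : lie_action G P) (alpha : cartan_cochain G P) : cartan_cochain G P :=
  fun x => ext_d (alpha x) - contract (fund a x) (alpha x).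

Definition rcartan (R : realType) (G : lieGroup R) (N M : manifold R) :
  lmodType R := (cartan_cochain G N * cartan_cochain G M)%type.

Definition rcartan_deg (R : realType) (G : lieGroup R) (N M : manifold R)
    (aN : lie_action G N) (aM : lie_action G M) : nat -> set (rcartan G N M) :=
  cone_deg (cartan_deg aN) (cartan_deg aM).

Definition rcartan_d (R : realType) (G : lieGroup R) (N M : manifold R)
    (aN : lie_action G N) (aM : lie_action G M) (F : M -> N)
    : rcartan G N M -> rcartan G N M :=
  cone_d (cartan_d aN) (cartan_d aM) (val_pull F).

(* (S^i(g^vee) (x) Omega^q(F))^G *)
Definition rinv_poly_form (R : realType) (G : lieGroup R) (N M : manifold R)
    (aN : lie_action G N) (aM : lie_action G M) (i : nat)
    : nat -> set (rcartan G N M) :=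
  cone_deg (inv_poly_form aN i) (inv_poly_form aM i).

Definition rconst (R : realType) (G : lieGroup R) (N M : manifold R)
    (w : rform N M) : rcartan G N M := (fun=> w.1, fun=> w.2).

(* w - \sum_(i >= 1) P_i is an extension of w with components P_i; only the
   indices with 2 i <= n + 1 give forms of nonnegative degree. *)
Definition extension_by (R : realType) (G : lieGroup R) (N M : manifold R)
    (aN : lie_action G N) (aM : lie_action G M) (F : M -> N) (n : nat)
    (w : rform N M) (P : nat -> rcartan G N M) (wG : rcartan G N M) :=
  [/\ forall i, (1 <= i)%N ->
        if (2 * i <= n.+1)%N then rinv_poly_form aN aM i (n.+1 - 2 * i) (P i)
        else P i = 0,
      wG = rconst G w - \sum_(1 <= i < n.+2) P i,
      rcartan_deg aN aM n.+1 wG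
    & rcartan_d aN aM F wG = 0].

Definition extension (R : realType) (G : lieGroup R) (N M : manifold R)
    (aN : lie_action G N) (aM : lie_action G M) (F : M -> N) (n : nat)
    (w : rform N M) (wG : rcartan G N M) :=
  exists P, extension_by aN aM F n w P wG.

Definition one_step_extension (R : realType) (G : lieGroup R)
    (N M : manifold R) (aN : lie_action G N) (aM : lie_action G M) (F : M -> N)
    (n : nat) (w : rform N M) (mu : rcartan G N M) :=
  extension_by aN aM F n w (fun i => if i == 1%N then mu else 0)
    (rconst G w - mu).

(** ** Relative homotopy moment maps *)

Definition varsigma (R : realType) (k : nat) : R :=
  - (-1) ^+ (k * k.+1 %/ 2).

(* The component f_k is the restriction of f to lists of length k; the first
   condition includes the convention f_0 = f_(n+1) = 0. *)
Definition homotopy_moment_map (R : realType) (G : lieGroup R)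
    (N M : manifold R) (aN : lie_action G N) (aM : lie_action G M) (F : M -> N)
    (n : nat) (w : rform N M) (f : seq (lieAlg G) -> rform N M) :=
  [/\ forall xs, ~~ (1 <= size xs <= n)%N -> f xs = 0,
      alt_multilinear f,
      forall xs, (1 <= size xs <= n)%N -> rOmega (n - size xs) (f xs)
    & forall xs, (1 <= size xs <= n.+1)%N ->
        - delta_CE f xs =
        rext_d F (f xs) + varsigma R (size xs) *: rcontracts aN aM xs w].

(* f_k(x_1, .., x_k)
     = varsigma(k) iota(v_(x_1) /\ .. /\ v_(x_(k-1))) mu(x_k), 1 <= k <= n *)
Definition induced_moment_map (R : realType) (G : lieGroup R)
    (N M : manifold R) (aN : lie_action G N) (aM : lie_action G M) (n : nat)
    (mu : rcartan G N M) (xs : seq (lieAlg G)) : rform N M :=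
  if xs is x :: s then
    if (size xs <= n)%N then
      varsigma R (size xs) *:
        rcontracts aN aM (belast x s) (mu.1 (last x s), mu.2 (last x s))
    else 0
  else 0.

(* Main.v *)
(* In charts, the pullback of a form by f is composition with the local
   expression phi of f and with its differential, so its smoothness follows from
   the chain rule and multilinearity. Differentiating it produces, besides the
   pulled back derivative, terms with the second derivatives of phi: in the
   exterior derivative they cancel because second derivatives are symmetric and
   forms are alternating; in the Lie derivative they are compensated by
   differentiating the identity that says that the vector fields are f-related.
   The fundamental vector fields are phi-related because phi is equivariant, and
   smooth because they are partial derivatives of the action. Everything else is
   linear algebra, applied on both components of the mapping cones. *)

Require Import Defs.
From mathcomp Require Import zify.
Set Implicit Arguments.
Unset Strict Implicit.
Unset Printing Implicit Defensive.

(** * Symmetry of second derivatives *)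

(** A row vector stands for a tangent vector only relative to the preferred chart of its base point,
    and this chart need not vary continuously with the point. The values of a form or a vector field
    therefore have no meaningful derivative as they stand. Whatever is differentiated is first moved
    to one fixed chart ([form_in], [vfield_in]), and a chart transition is treated as the local
    expression of the identity map; naturality, composition and change of chart then all come from
    one chain rule, [derive_chart_comp]. A second obstacle is that forms take lists of arbitrary
    length: the varying arguments are made constant one at a time by expansion in the canonical
    basis, which reduces smoothness and the product rule to scalar functions. Symmetry of second
    derivatives comes from the mean value theorem, applied twice on small parallelograms. *)

Lemma near_eq_differentiable (R : realType) (V W : normedModType R)
    (f g : V -> W) (x : V) :
  {near x, f =1 g} -> differentiable f x -> differentiable g x.
Proof.
move=> fg df.
suff dh : differentiable (g - f) x.
  by rewrite -(subrK f g); exact: differentiableD.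
(* As g - f vanishes near x, its first-order expansion holds with zero linear part, and
   [diff_unique] identifies its differential with 0. *)
have h0 : (g - f) \o shift x = cst ((g - f) x) + (cst 0 : V -> W) +o_ 0 id.
  apply/eqaddoP => e e0.
  have /= fg0 : \forall y \near (0 : V), f (y + x) = g (y + x).
    by rewrite (near_shift x) /=; near=> z; rewrite /= sub0r addrNK; near: z.
  near=> y.
  rewrite -[X in `|X|]/(g (y + x) - f (y + x) - (g x - f x + 0)).
  rewrite (near fg0 y) // (nbhs_singleton fg) addr0 !subrr normr0.
  by rewrite mulr_ge0 // ltW.
pose zL : {linear V -> W} := \0.
have cz : continuous zL by move=> y; exact: cvg_cst.
have E := diff_unique cz h0.
apply/diff_locallyP; split.
  by rewrite E.
by rewrite E.
Unshelve. all: by end_near. Qed.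

Lemma derive_comp (R : realType) (U V W : normedModType R) (f : U -> V)
    (g : V -> W) (x v : U) :
  differentiable f x -> differentiable g (f x) ->
  'D_v (g \o f) x = 'D_('D_v f x) g (f x).
Proof.
move=> df dg; rewrite !deriveE //; last exact: differentiable_comp.
by rewrite diff_comp.
Qed.

Lemma derive_dirP (R : realType) (V W : normedModType R) (f : V -> W)
    (x u v : V) (a : R) : differentiable f x ->
  'D_(a *: u + v) f x = a *: 'D_u f x + 'D_v f x.
Proof. by move=> df; rewrite !deriveE // linearP. Qed.

Lemma derive_line (R : realType) (V : normedModType R) (x v : V) (t : R^o) :
  'D_1 (fun t : R^o => t *: v + x) t = v.
Proof.
rewrite deriveE // -[(fun _ => _)]/(( *:%R ^~ v : R^o -> V) + cst x).
by rewrite diff_val /= addr0 scale1r.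
Qed.

Lemma is_derive_line (R : realType) (V W : normedModType R) (f : V -> W)
    (x v : V) (t : R^o) : differentiable f (t *: v + x) ->
  is_derive t 1 (fun t : R^o => f (t *: v + x)) ('D_v f (t *: v + x)).
Proof.
move=> df; apply: DeriveDef.
  apply: diff_derivable.
  exact: (@differentiable_comp _ _ _ _ (fun t : R^o => t *: v + x) f).
rewrite (@derive_comp _ _ _ _ (fun t : R^o => t *: v + x) f) //.
by rewrite derive_line.
Qed.

Lemma mvt_line (R : realType) (V : normedModType R) (f : V -> R^o) (x v : V)
    (s : R) : 0 < s ->
  (forall t : R, 0 <= t <= s -> differentiable f (t *: v + x)) ->
  exists2 t : R, 0 <= t <= s & f (s *: v + x) - f x = 'D_v f (t *: v + x) * s.
Proof.
move=> s0 df.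
pose h := fun t : R => f (t *: v + x).
have [||t + E] := @MVT R h (fun t => 'D_v f (t *: v + x)) 0 s s0.
- move=> t; rewrite in_itv /= => /andP[t0 ts].
  by apply: is_derive_line; apply: df; rewrite !ltW.
- apply: continuous_in_subspaceT => t /[!inE] /=.
  rewrite in_itv /= => /df d.
  apply: (@differentiable_continuous _ _ _ _ (h : R^o -> R^o)).
  exact: (@differentiable_comp _ _ _ _ (fun t : R^o => t *: v + x) f).
rewrite in_itv /= => /andP[t0 ts]; exists t; first by rewrite !ltW.
by move: E; rewrite /h scale0r add0r subr0.
Qed.

(** The mean value theorem is applied in direction v to the increment [h] of f by s w, then in
    direction w to ['D_v f]. Up to rearrangement the second difference is symmetric in v and w, so
    it links both orders of differentiation. *)
Lemma second_difference (R : realType) (V : normedModType R) (f : V -> R^o)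
    (x v w : V) (s : R) : 0 < s ->
  (forall a b : R, 0 <= a <= s -> 0 <= b <= s ->
     differentiable f (a *: v + (b *: w + x)) /\
     differentiable ('D_v f) (a *: v + (b *: w + x))) ->
  exists a b : R, [/\ 0 <= a <= s, 0 <= b <= s &
    f (s *: v + (s *: w + x)) - f (s *: v + x) - (f (s *: w + x) - f x)
      = 'D_w ('D_v f) (a *: v + (b *: w + x)) * s * s].
Proof.
move=> s0 df.
pose h := fun y : V => f (s *: w + y) - f y.
have s00 : 0 <= s <= s by rewrite lexx ltW.
have z00 : 0 <= (0 : R) <= s by rewrite lexx ltW.
have d1 (t : R) : 0 <= t <= s -> differentiable (f \o (+%R (s *: w))) (t *: v + x).
  move=> ts; apply: differentiable_comp => /=; last first.
    by rewrite addrCA; have [] := df t s ts s00.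
  exact: (@differentiableD _ _ _ (cst (s *: w)) id).
have d2 (t : R) : 0 <= t <= s -> differentiable f (t *: v + x).
  by move=> ts; have := df t 0 ts z00; rewrite scale0r add0r => -[].
have [|t ts Et] := @mvt_line R V h x v s s0.
  by move=> t ts; exact: differentiableB (d1 _ ts) (d2 _ ts).
have Dh : 'D_v h (t *: v + x) =
    'D_v f (s *: w + (t *: v + x)) - 'D_v f (t *: v + x).
  rewrite -[h]/((f \o (+%R (s *: w))) - f) deriveB; last 2 first.
  - exact/diff_derivable/d1.
  - exact/diff_derivable/d2.
  rewrite derive_comp /=; last 2 first.
  - exact: (@differentiableD _ _ _ (cst (s *: w)) id).
  - by rewrite addrCA; have [] := df t s ts s00.
  congr (_ - _).
  rewrite -[(+%R (s *: w))]/(cst (s *: w) + id) deriveD.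
  - by rewrite derive_cst derive_id add0r.
  - exact: derivable_cst.
  - exact: derivable_id.
have [|b bs Eb] := @mvt_line R V ('D_v f) (t *: v + x) w s s0.
  by move=> b bs; rewrite addrCA; have [] := df t b ts bs.
exists t, b; split => //.
move: Et; rewrite /h [s *: w + (s *: v + x)]addrCA => ->.
by rewrite Dh Eb [b *: w + (t *: v + x)]addrCA.
Qed.

(** On a small parallelogram at x the second difference is s^2 times either mixed derivative, each
    taken at some point of the parallelogram. Cancelling s^2 and using continuity of both
    derivatives at x puts their values at x within e of each other, for every e > 0. *)
Lemma derive_sym (R : realType) (V : normedModType R) (f : V -> R^o)
    (U : set V) (x v w : V) : open U -> U x -> cont_diff 2 U f ->
  'D_w ('D_v f) x = 'D_v ('D_w f) x.
Proof.
move=> oU Ux /= [_ [df /all_and2 [_ /all_and2[dD cD]]]].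
have {}cD a b : {for x, continuous ('D_a ('D_b f))} by case: (cD b a) => /(_ x Ux).
apply/eqP; rewrite -subr_eq0 -normr_le0; apply/ler_addgt0Pr => e e0.
rewrite add0r.
have tri (a b c : R) : `|a - c| < e / 2 -> `|b - c| < e / 2 -> `|a - b| <= e.
  move=> ac bc; rewrite -(subrKA c) (splitr e).
  by apply: le_trans (ler_normD _ _) _; rewrite (distrC c) lerD // ltW.
have nU : nbhs x U by exact: open_nbhs_nbhs.
have e20 : 0 < e / 2 by rewrite divr_gt0.
have /cvgrPdist_lt /(_ _ e20) n1 := cD w v.
have /cvgrPdist_lt /(_ _ e20) n2 := cD v w.
have nb : nbhs x (U `&` ((fun t => `|'D_w ('D_v f) x - 'D_w ('D_v f) t| < e / 2)
    `&` (fun t => `|'D_v ('D_w f) x - 'D_v ('D_w f) t| < e / 2))).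
  by apply: filterI => [//|]; exact: filterI n1 n2.
have [r /= r0 rU] := (@nbhs_ballP R V x _).1 nb.
(* The summand 1 keeps c positive when v = w = 0 and makes s (|v| + |w|) < r strict. *)
pose c := `|v| + `|w| + 1.
have c0 : 0 < c by rewrite ltr_wpDl // addr_ge0.
pose s := r / c.
have s0 : 0 < s by rewrite divr_gt0.
have inr_ a b : 0 <= a <= s -> 0 <= b <= s -> ball x r (a *: v + (b *: w + x)).
  move=> /andP[a0 as_] /andP[b0 bs].
  rewrite -ball_normE /= addrA opprD addrCA subrr addr0 normrN.
  apply: le_lt_trans (ler_normD _ _) _; rewrite !normrZ !ger0_norm //.
  apply: (@le_lt_trans _ _ (s * (`|v| + `|w|))).
    by rewrite mulrDr lerD // ler_wpM2r.
  by rewrite /s mulrAC -mulrA gtr_pMr // ltr_pdivrMr // mul1r /c ltrDl.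
have [|a [b [as_ bs E1]]] := @second_difference R V f x v w s s0.
  move=> a b as_ bs; have /rU[/= Uab _] := inr_ _ _ as_ bs.
  by split; [exact: df|exact: dD].
have [|a' [b' [as' bs' E2]]] := @second_difference R V f x w v s s0.
  move=> a' b' as' bs'; have /rU[/= Uab _] := inr_ _ _ bs' as'.
  by rewrite addrCA; split; [exact: df|exact: dD].
rewrite (addrCA (s *: w)) (addrCA (a' *: w)) in E2.
have E : 'D_w ('D_v f) (a *: v + (b *: w + x)) =
         'D_v ('D_w f) (b' *: v + (a' *: w + x)).
  apply: (mulIf (lt0r_neq0 s0)); apply: (mulIf (lt0r_neq0 s0)).
  apply: etrans (esym E1) (etrans _ E2).
  by rewrite !opprB addrACA [RHS]addrACA [X in _ + X = _]addrC.
have /rU[_ [/= h1 _]] := inr_ _ _ as_ bs.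
have /rU[_ [_ /= h2]] := inr_ _ _ bs' as'.
rewrite -E in h2; exact: tri h1 h2.
Qed.

(** * Functions of class C^k and alternating maps *)

Lemma cont_diff_mono (R : realType) (k : nat) (V W : normedModType R)
    (A B : set V) (f : V -> W) :
  A `<=` B -> cont_diff k B f -> cont_diff k A f.
Proof.
move=> AB; elim: k f => [|k IH] f /= [cf H]; split=> //.
- by move=> x /AB /cf.
- by move=> x /AB /cf.
- case: H => df Df; split; first by move=> x /AB /df.
  by move=> v; apply: IH.
Qed.

Lemma cont_diffW (R : realType) (k : nat) (V W : normedModType R)
    (A : set V) (f : V -> W) : cont_diff k.+1 A f -> cont_diff k A f.
Proof.
elim: k f => [|k IH] f /= [cf [df Df]]; split => //; split => // v.
exact/IH/Df.
Qed.

(** Openness turns equality on U into equality near each point of U, so differentiability and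
    directional derivatives carry over and the induction can pass to ['D_v f] and ['D_v g]. *)
Lemma cont_diff_eq (R : realType) (k : nat) (V W : normedModType R)
    (U : set V) (f g : V -> W) :
  open U -> (forall x, U x -> f x = g x) ->
  cont_diff k U f -> cont_diff k U g.
Proof.
move=> oU; elim: k f g => [|k IH] f g fg /= [cf Hf].
all: have nfg x : U x -> {near x, f =1 g}.
all: try by move=> Ux; near=> y; apply: fg; near: y; exact: open_nbhs_nbhs.
all: have cg x : U x -> {for x, continuous g}.
all: try (move=> Ux; rewrite /prop_for /continuous_at -(fg _ Ux);
  apply: cvg_trans (cf x Ux); apply: near_eq_cvg; exact: nfg).
- by split.
- split=> //; case: Hf => df Df; split.
    by move=> x Ux; apply: near_eq_differentiable (nfg _ Ux) (df _ Ux).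
  move=> v; apply: IH (Df v) => x Ux.
  by apply: near_eq_derive; exact: nfg.
Unshelve. all: by end_near. Qed.

(** Each clause of [cont_diff] is a condition at single points, so a different set may be used at
    each point; this allows a choice of target chart depending on the point. *)
Lemma cont_diff_cover (R : realType) (k : nat) (V W : normedModType R)
    (U : set V) (f : V -> W) :
  (forall x, U x -> exists2 A : set V, A x & cont_diff k A f) ->
  cont_diff k U f.
Proof.
elim: k f => [|k IH] f /= H; split=> //.
- by move=> x /H[A Ax []]; auto.
- by move=> x /H[A Ax []]; auto.
- split; first by move=> x /H[A Ax [_ []]]; auto.
  by move=> v; apply: IH => x /H[A Ax [_ [_ D]]]; exists A.
Qed.

Lemma cont_diff_differentiable (R : realType) (k : nat) (V W : normedModType R)
    (U : set V) (f : V -> W) x : cont_diff k.+1 U f -> U x -> differentiable f x.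
Proof. by move=> [_ [+ _]]; exact. Qed.

Lemma cont_diff_derive (R : realType) (k : nat) (V W : normedModType R)
    (U : set V) (f : V -> W) v : cont_diff k.+1 U f -> cont_diff k U ('D_v f).
Proof. by move=> [_ [_]]; exact. Qed.

Lemma cont_diff_continuous (R : realType) (k : nat) (V W : normedModType R)
    (U : set V) (f : V -> W) x :
  cont_diff k U f -> U x -> {for x, continuous f}.
Proof. by case: k => [|k] [+ _]; exact. Qed.

Lemma cont_diff_cst (R : realType) (k : nat) (V W : normedModType R)
    (U : set V) (a : W) : cont_diff k U (fun _ : V => a).
Proof.
elim: k a => [|k IH] a /=; split=> //; try by move=> x _; exact: cvg_cst.
split; first by move=> x _; exact: differentiable_cst.
move=> v; have -> : 'D_v (fun _ : V => a) = (fun _ : V => 0 : W).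
  by apply/funext => x; exact: derive_cst.
exact: IH.
Qed.

Lemma cont_diffD (R : realType) (k : nat) (V W : normedModType R)
    (U : set V) (f g : V -> W) : open U ->
  cont_diff k U f -> cont_diff k U g -> cont_diff k U (fun x => f x + g x).
Proof.
move=> oU; elim: k f g => [|k IH] f g [cf Hf] [cg Hg].
  by split=> // x Ux; apply: continuousD; [exact: cf|exact: cg].
case: Hf Hg => [df Df] [dg Dg]; split.
  by move=> x Ux; apply: continuousD; [exact: cf|exact: cg].
split=> [x Ux|v]; first by apply: differentiableD; [exact: df|exact: dg].
apply: cont_diff_eq (IH _ _ (Df v) (Dg v)) => // x Ux.
by rewrite -[(fun x => _)]/(f + g) deriveD //;
   apply: diff_derivable; [exact: df|exact: dg].
Qed.

Lemma cont_diffM (R : realType) (k : nat) (V : normedModType R)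
    (U : set V) (f g : V -> R^o) : open U ->
  cont_diff k U f -> cont_diff k U g ->
  cont_diff k U (fun x => f x * g x : R^o).
Proof.
move=> oU; elim: k f g => [|k IH] f g sf sg.
  by split=> // x Ux; apply: (@continuousM R V f g x); [exact: sf.1|exact: sg.1].
split.
  by move=> x Ux; apply: (@continuousM R V f g x); [exact: sf.1|exact: sg.1].
split=> [x Ux|v].
  by apply: (@differentiableM R V f g); [exact: cont_diff_differentiable sf Ux|
    exact: cont_diff_differentiable sg Ux].
have H := cont_diffD oU (IH _ _ (cont_diffW sf) (cont_diff_derive v sg))
  (IH _ _ (cont_diffW sg) (cont_diff_derive v sf)).
apply: cont_diff_eq H => // x Ux.
have df := cont_diff_differentiable sf Ux.
have dg := cont_diff_differentiable sg Ux.
rewrite -[(fun x => f x * g x)]/((f : V -> R) * g) deriveM.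
- by [].
- exact: diff_derivable.
- exact: diff_derivable.
Qed.

Lemma cont_diff_sum (R : realType) (k : nat) (V W : normedModType R)
    (U : set V) (I : Type) (r : seq I) (f : I -> V -> W) : open U ->
  (forall i, cont_diff k U (f i)) ->
  cont_diff k U (fun x => \sum_(i <- r) f i x).
Proof.
move=> oU sf; elim: r => [|i r IH].
  rewrite (_ : (fun x => _) = fun=> 0); first exact: cont_diff_cst.
  by apply/funext => x; rewrite big_nil.
rewrite (_ : (fun x => _) = fun x => f i x + \sum_(i <- r) f i x).
  exact: cont_diffD.
by apply/funext => x; rewrite big_cons.
Qed.

Lemma differentiable_rV_coord (R : realType) (V : normedModType R) n
    (f : V -> 'rV[R]_n) x (j : 'I_n) :
  differentiable f x -> differentiable (fun x => f x 0 j : R^o) x.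
Proof.
move=> df.
apply: (@differentiable_comp _ _ _ _ f (fun N : 'rV[R]_n => N 0 j : R^o)) => //.
exact: differentiable_coord.
Qed.

Lemma derive_coord (R : realType) (V : normedModType R) n (f : V -> 'rV[R]_n)
    x v (j : 'I_n) : differentiable f x ->
  'D_v (fun x => f x 0 j : R^o) x = ('D_v f x) 0 j.
Proof.
by move=> df; rewrite derive_mx ?mxE //; exact: diff_derivable.
Qed.

Lemma cont_diff_coord (R : realType) (k : nat) (V : normedModType R) n
    (U : set V) (f : V -> 'rV[R]_n) (j : 'I_n) : open U ->
  cont_diff k U f -> cont_diff k U (fun x => f x 0 j : R^o).
Proof.
move=> oU; elim: k f => [|k IH] f [cf Hf].
all: have cfj x : U x -> {for x, continuous (fun x => f x 0 j : R^o)}.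
all: try by move=> Ux; apply: (@continuous_comp _ _ _ f
  (fun N : 'rV[R]_n => N 0 j : R^o)); [exact: cf|exact: coord_continuous].
  by split.
split=> //; case: Hf => df Df; split=> [x Ux|v].
  exact/differentiable_rV_coord/df.
apply: cont_diff_eq (IH _ (Df v)) => // x Ux.
by rewrite derive_coord //; exact: df.
Qed.

(** Turns a derivative in a direction that may vary with the point into partial derivatives in fixed
    directions with scalar coefficients, to which sum and product rules apply. *)
Lemma derive_row_expand (R : realType) n (W : normedModType R)
    (g : 'rV[R]_n -> W) (y v : 'rV[R]_n) : differentiable g y ->
  'D_v g y = \sum_(j < n) v 0 j *: 'D_(delta_mx 0 j) g y.
Proof.
move=> dg; rewrite deriveE // {1}(row_sum_delta v) linear_sum /=.
by apply: eq_bigr => j _; rewrite linearZ /= deriveE.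
Qed.

(** By the chain rule, ['D_v (g \o f)] is a sum of products of coordinates of ['D_v f] with partial
    derivatives of g composed with f; these are covered by the induction hypothesis one order
    lower. *)
Lemma cont_diff_comp (R : realType) (k : nat) (V : normedModType R) n
    (U : set V) (U' : set 'rV[R]_n) (f : V -> 'rV[R]_n) (g : 'rV[R]_n -> R^o) :
  open U -> (forall x, U x -> U' (f x)) ->
  cont_diff k U f -> cont_diff k U' g -> cont_diff k U (fun x => g (f x)).
Proof.
move=> oU UU'; elim: k g => [|k IH] g sf sg.
  split=> // x Ux; apply: (@continuous_comp _ _ _ f g).
    exact: cont_diff_continuous sf Ux.
  exact: cont_diff_continuous sg (UU' _ Ux).
split.
  move=> x Ux; apply: (@continuous_comp _ _ _ f g).
    exact: cont_diff_continuous sf Ux.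
  exact: cont_diff_continuous sg (UU' _ Ux).
split=> [x Ux|v].
  apply: (@differentiable_comp _ _ _ _ f g).
    exact: cont_diff_differentiable sf Ux.
  exact: cont_diff_differentiable sg (UU' _ Ux).
have H : cont_diff k U (fun x => \sum_(j < n)
    (('D_v f x) 0 j * 'D_(delta_mx 0 j) g (f x) : R^o)).
  apply: cont_diff_sum => // j; apply: cont_diffM => //.
    by apply: cont_diff_coord => //; exact: cont_diff_derive.
  exact: (IH _ (cont_diffW sf) (cont_diff_derive (delta_mx 0 j) sg)).
apply: cont_diff_eq H => // x Ux.
have df := cont_diff_differentiable sf Ux.
have dg := cont_diff_differentiable sg (UU' _ Ux).
by rewrite -[(fun x => g (f x))]/(g \o f) (derive_comp v df dg)
  (derive_row_expand _ dg).
Qed.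

Lemma derive_sym_rV (R : realType) (V : normedModType R) n (f : V -> 'rV[R]_n)
    (U : set V) (x v w : V) : open U -> U x -> cont_diff 2 U f ->
  'D_w ('D_v f) x = 'D_v ('D_w f) x.
Proof.
move=> oU Ux sf; apply/rowP => j.
have df a : differentiable ('D_a f) x.
  exact: cont_diff_differentiable (cont_diff_derive a sf) Ux.
have nU : nbhs x U by exact: open_nbhs_nbhs.
have E a b : 'D_a ('D_b (fun y => f y 0 j : R^o)) x =
             'D_a (fun y => 'D_b f y 0 j : R^o) x.
  apply: near_eq_derive; near=> y; apply: derive_coord.
  by apply: cont_diff_differentiable sf _; near: y.
apply: etrans (esym (derive_coord w j (df v))) _.
apply: etrans _ (derive_coord v j (df w)).
apply: etrans (esym (E w v)) _.
apply: etrans _ (E v w).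
exact: derive_sym oU Ux (cont_diff_coord j oU sf).
Unshelve. all: by end_near. Qed.

(** * Multilinear expansion and signs of alternating maps on lists *)

Lemma alt_multilinear_sum (R : realType) (V W : lmodType R) (f : seq V -> W)
    (I : Type) (r : seq I) (a : I -> R) (e : I -> V) s1 s2 :
  alt_multilinear f ->
  f (s1 ++ (\sum_(i <- r) a i *: e i) :: s2) =
  \sum_(i <- r) a i *: f (s1 ++ e i :: s2).
Proof.
move=> [fl _]; elim: r => [|i r IH]; rewrite ?big_nil ?big_cons.
  by have := fl s1 s2 (-1) 0 0; rewrite scaler0 addr0 scaleN1r addNr.
by rewrite fl IH.
Qed.

Lemma alt_multilinear_expand (R : realType) n (W : lmodType R)
    (f : seq 'rV[R]_n -> W) (u : 'rV[R]_n) s1 s2 :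
  alt_multilinear f ->
  f (s1 ++ u :: s2) = \sum_(j < n) u 0 j *: f (s1 ++ delta_mx 0 j :: s2).
Proof. by move=> fl; rewrite {1}(row_sum_delta u) alt_multilinear_sum. Qed.

(** Polarization: f vanishes when u + v fills both slots, and of the four terms of the expansion the
    two with a repeated entry vanish. *)
Lemma alt_multilinear_swap (R : realType) (V W : lmodType R) (f : seq V -> W)
    s1 s2 u v : alt_multilinear f ->
  f (s1 ++ u :: v :: s2) = - f (s1 ++ v :: u :: s2).
Proof.
move=> [fl f0].
have := f0 s1 [::] s2 (1 *: u + v); rewrite /= fl.
rewrite -!(cat_rcons u) -!(cat_rcons v) !fl !cat_rcons.
rewrite !scale1r (f0 s1 [::] s2 u) (f0 s1 [::] s2 v) add0r addr0.
by move/eqP; rewrite addr_eq0 => /eqP.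
Qed.

Lemma alt_multilinear_move (R : realType) (V W : lmodType R) (f : seq V -> W)
    s1 s2 s3 b : alt_multilinear f ->
  f (s1 ++ b :: s2 ++ s3) = (-1) ^+ size s2 *: f (s1 ++ s2 ++ b :: s3).
Proof.
move=> fa; elim: s2 s1 => [|x s2 IH] s1 /=; first by rewrite scale1r.
by rewrite (alt_multilinear_swap _ _ _ _ fa) -cat_rcons IH cat_rcons exprS
  mulN1r scaleNr.
Qed.

(** Agrees with [set_nth] below the size of the list, but is written with [take] and [drop] to
    combine with [rem_at]. *)
Definition replace (T : Type) (i : nat) (y : T) (s : seq T) :=
  take i s ++ y :: drop i.+1 s.

Lemma replace_cat (T : Type) (s1 s2 : seq T) (x y : T) :
  replace (size s1) y (s1 ++ x :: s2) = s1 ++ y :: s2.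
Proof.
by rewrite /replace take_size_cat // -[s1 ++ x :: _]cat_rcons
  drop_size_cat ?size_rcons.
Qed.

Lemma rem_at_cat (T : Type) (s1 s2 : seq T) (x : T) :
  rem_at (size s1) (s1 ++ x :: s2) = s1 ++ s2.
Proof.
by rewrite /rem_at take_size_cat // -[s1 ++ x :: _]cat_rcons
  drop_size_cat ?size_rcons.
Qed.

(** Let x and y be the entries of t at positions i and j + 1. Both lists arise from t by dropping x
    and y and inserting b, at the place of y on the left and of x on the right. Moving b across the
    j - i entries in between costs (-1)^(j - i), and j + 1 + (j - i) differs from i by an odd
    number. *)
Lemma alt_multilinear_rem_antisym (R : realType) (V : lmodType R)
    (f : seq V -> R^o) (t : seq V) (b : V) (i j : nat) :
  alt_multilinear f -> (i <= j)%N -> (j.+1 < size t)%N ->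
  (-1) ^+ i * f (replace j b (rem_at i t))
  = - ((-1) ^+ j.+1 * f (replace i b (rem_at j.+1 t))).
Proof.
move=> fa ij jt.
have it : (i < size t)%N by lia.
have [t1 [x [t2 [y [t3 [-> s1 s2]]]]]] : exists t1 x t2 y t3,
    [/\ t = t1 ++ x :: t2 ++ y :: t3, size t1 = i & size t2 = (j - i)%N].
  exists (take i t), (nth 0 t i), (take (j - i) (drop i.+1 t)), (nth 0 t j.+1),
    (drop j.+2 t); split; last 2 first.
  - by rewrite size_takel // ltnW.
  - by rewrite size_takel // size_drop; lia.
  rewrite -[in LHS](cat_take_drop i t) (drop_nth 0) //; congr (_ ++ _ :: _).
  rewrite -[in LHS](cat_take_drop (j - i) (drop i.+1 t)); congr (_ ++ _).
  by rewrite drop_drop addnS subnK // -drop_nth.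
have -> : replace j b (rem_at i (t1 ++ x :: t2 ++ y :: t3)) = t1 ++ t2 ++ b :: t3.
  have -> : j = size (t1 ++ t2) by rewrite size_cat s1 s2; lia.
  by rewrite -s1 rem_at_cat !catA replace_cat.
have -> : replace i b (rem_at j.+1 (t1 ++ x :: t2 ++ y :: t3)) = t1 ++ b :: t2 ++ t3.
  have -> : j.+1 = size (t1 ++ x :: t2) by rewrite size_cat /= s1 s2; lia.
  by rewrite -cat_cons catA rem_at_cat -catA -s1 replace_cat.
rewrite (alt_multilinear_move _ _ _ _ fa) s2 -[_ *: _]/(_ * _) mulrA -exprD.
by rewrite (_ : j.+1 + (j - i) = i + (j - i).*2.+1)%N; [|lia];
  rewrite exprD exprS -muln2 mulnC exprM sqrrN expr1n expr1n mulr1 mulrN1 mulNr opprK.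
Qed.

(** Expanding the last varying entry in the canonical basis leaves scalar coefficients and a
    constant vector, which joins the tail [t]; this is why the statement carries a constant tail. *)
Lemma cont_diff_alt_multilinear (R : realType) (k : nat) (V : normedModType R)
    (n : nat) (U : set V) (K : V -> seq 'rV[R]_n -> R^o) (I : Type)
    (A : I -> V -> 'rV[R]_n) (l : seq I) (t : seq 'rV[R]_n) :
  open U -> (forall u, U u -> alt_multilinear (K u)) ->
  (forall s, cont_diff k U (fun u => K u s)) ->
  (forall i, cont_diff k U (A i)) ->
  cont_diff k U (fun u => K u ([seq A i u | i <- l] ++ t)).
Proof.
move=> oU Ka sK sA; elim/last_ind: l t => [//|l i IH] t.
have H : cont_diff k U (fun u => \sum_(j < n)
    (A i u 0 j * K u ([seq A i u | i <- l] ++ delta_mx 0 j :: t) : R^o)).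
  by apply: cont_diff_sum => // j; apply: cont_diffM => //; exact: cont_diff_coord.
apply: cont_diff_eq H => // u Uu.
by rewrite map_rcons cat_rcons (alt_multilinear_expand _ _ _ (Ka u Uu)).
Qed.

Lemma derive_big (R : realType) (V W : normedModType R) n (f : 'I_n -> V -> W)
    x v : (forall i, differentiable (f i) x) ->
  'D_v (fun u => \sum_(i < n) f i u) x = \sum_(i < n) 'D_v (f i) x.
Proof.
move=> df; rewrite -derive_sum; last by move=> i; exact: diff_derivable.
by congr ('D_v _ x); apply/funext => u; rewrite fct_sumE.
Qed.

Lemma derive_mul (R : realType) (V : normedModType R) (f g : V -> R^o) x v :
  differentiable f x -> differentiable g x ->
  'D_v (fun u => f u * g u : R^o) x = f x * 'D_v g x + 'D_v f x * g x.
Proof.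
move=> df dg; rewrite -[(fun u => f u * g u)]/((f : V -> R) * g) deriveM.
- by rewrite [X in _ + X]mulrC.
- exact: diff_derivable.
- exact: diff_derivable.
Qed.

(* By induction on l: expanding the last entry A i u in the canonical basis
   reduces to the Leibniz rule for products of scalar functions. *)
Lemma derive_alt_multilinear (R : realType) (V : normedModType R)
    (n : nat) (U : set V) (K : V -> seq 'rV[R]_n -> R^o) (I : Type) (i0 : I)
    (A : I -> V -> 'rV[R]_n) (l : seq I) (t : seq 'rV[R]_n) (x v : V) :
  open U -> U x -> (forall u, U u -> alt_multilinear (K u)) ->
  (forall s, cont_diff 1 U (fun u => K u s)) ->
  (forall i, cont_diff 1 U (A i)) ->
  let s := [seq A i x | i <- l] ++ t in
  'D_v (fun u => K u ([seq A i u | i <- l] ++ t)) x =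
  'D_v (fun u => K u s) x +
  \sum_(q < size l) K x (replace q ('D_v (A (nth i0 l q)) x) s).
Proof.
move=> oU Ux Ka sK sA /=; elim/last_ind: l t => [|l i IH] t.
  by rewrite big_ord0 addr0.
have dA j : differentiable (fun u => A i u 0 j : R^o) x.
  exact: cont_diff_differentiable (cont_diff_coord j oU (sA i)) Ux.
have dAi : differentiable (A i) x by exact: cont_diff_differentiable (sA i) Ux.
have dK s : differentiable (fun u => K u s) x.
  exact: cont_diff_differentiable (sK s) Ux.
have dKA s : differentiable (fun u => K u ([seq A i u | i <- l] ++ s)) x.
  exact: cont_diff_differentiable
    (@cont_diff_alt_multilinear _ _ _ _ _ _ _ _ l s oU Ka sK sA) Ux.
have nU : nbhs x U by exact: open_nbhs_nbhs.
have -> : 'D_v (fun u => K u ([seq A i u | i <- rcons l i] ++ t)) x =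
    'D_v (fun u => \sum_(j < n)
      (A i u 0 j * K u ([seq A i u | i <- l] ++ delta_mx 0 j :: t) : R^o)) x.
  apply: near_eq_derive; near=> u.
  rewrite map_rcons cat_rcons (alt_multilinear_expand _ _ _ (Ka u _)) //.
  by near: u.
rewrite derive_big; last first.
  by move=> j; apply: differentiableM; [exact: dA|exact: dKA].
rewrite (eq_bigr (fun j => A i x 0 j * 'D_v (fun u => K u
    ([seq A i u | i <- l] ++ delta_mx 0 j :: t)) x + ('D_v (A i) x) 0 j *
    K x ([seq A i x | i <- l] ++ delta_mx 0 j :: t))); last first.
  move=> j _; rewrite -(derive_coord v j dAi).
  exact: (derive_mul v (dA j) (dKA (delta_mx 0 j :: t))).
under eq_bigr => j _ do rewrite IH.
(* The last slot holds the entry just peeled off, whose derivative comes from differentiating the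
   coefficients; all other terms come from the induction hypothesis. *)
rewrite big_split /= size_rcons big_ord_recr /= nth_rcons ltnn eqxx map_rcons
  cat_rcons addrA; congr (_ + _); last first.
  rewrite -(size_map (fun i => A i x) l) replace_cat.
  by rewrite (alt_multilinear_expand _ _ _ (Ka x Ux)).
under eq_bigr => j _ do rewrite mulrDr.
rewrite big_split /=; congr (_ + _).
  (* With the coefficients frozen at x, the sum over j recombines into K u with the constant entry A
     i x. *)
  transitivity ('D_v (fun u => \sum_(j < n) (A i x 0 j * K u
      ([seq A i x | i <- l] ++ delta_mx 0 j :: t) : R^o)) x).
    rewrite derive_big; last by move=> j; apply: differentiableM => //.
    apply: eq_bigr => j _.
    rewrite (@derive_mul _ _ (fun=> A i x 0 j) _ x v (differentiable_cst _ _)) //.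
    by rewrite (@derive_cst R V R^o) mul0r addr0.
  apply: near_eq_derive; near=> u.
  rewrite (alt_multilinear_expand _ _ _ (Ka u _)) //.
  by near: u.
under eq_bigr => j _ do rewrite mulr_sumr.
rewrite exchange_big /=; apply: eq_bigr => q _.
rewrite nth_rcons ltn_ord /replace.
have ql : (q < size [seq A i x | i <- l])%N by rewrite size_map.
rewrite take_cat ql.
have dq (y : 'rV[R]_n) : drop q.+1 ([seq A i x | i <- l] ++ y :: t) =
    drop q.+1 [seq A i x | i <- l] ++ y :: t.
  rewrite drop_cat; case: ltnP => // h.
  have -> : q.+1 = size [seq A i x | i <- l] by apply/eqP; rewrite eqn_leq ql.
  by rewrite subnn drop0 drop_size.
rewrite dq -cat_cons catA (alt_multilinear_expand _ _ _ (Ka x Ux)).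
by apply: eq_bigr => j _; rewrite take_cat ql dq -cat_cons catA.
Unshelve. all: by end_near. Qed.

(** * Local expressions and pullbacks of forms *)

Lemma chart_imP (R : realType) (T : topologicalType) m (c : chart R T m) u :
  chart_im c u -> chart_dom c (chart_inv c u) /\ c (chart_inv c u) = u.
Proof. by case=> p dp <-; rewrite chart_mapK. Qed.

Lemma chart_im_map (R : realType) (T : topologicalType) m (c : chart R T m) p :
  chart_dom c p -> chart_im c (c p).
Proof. by exists p. Qed.

Lemma local_domP (R : realType) (T T' : topologicalType) m m'
    (c : chart R T m) (c' : chart R T' m') (f : T -> T') u :
  (c @` (chart_dom c `&` f @^-1` chart_dom c')) u <->
  chart_im c u /\ chart_dom c' (f (chart_inv c u)).
Proof.
split=> [[p [dp dfp] <-]|[[p dp <-]]].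
  by rewrite chart_mapK //; split => //; exact: chart_im_map.
by rewrite chart_mapK // => dfp; exists p.
Qed.

Lemma local_dom_open (R : realType) (T T' : topologicalType) m m'
    (c : chart R T m) (c' : chart R T' m') (f : T -> T') :
  continuous f -> open (c @` (chart_dom c `&` f @^-1` chart_dom c')).
Proof.
move=> cf; rewrite openE => u /local_domP[iu du].
have n1 : nbhs u (chart_im c).
  by apply: open_nbhs_nbhs; split => //; exact: chart_open_im.
have n2 : nbhs u (fun u => chart_dom c' (f (chart_inv c u))).
  have n3 : nbhs (f (chart_inv c u)) (chart_dom c').
    by apply: open_nbhs_nbhs; split => //; exact: chart_open.
  exact: (chart_inv_cont iu (cf _ _ n3)).
rewrite /interior; near=> y; apply/local_domP; split; first by near: y.
by near: y.
Unshelve. all: by end_near. Qed.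

(** An action is given as jointly smooth, so for the map of a single group element this pointwise
    notion is what gets established. It suffices for the chain rule and also covers smooth maps and
    the identity. *)
Definition diff_at (R : realType) (M N : manifold R) (f : M -> N) (p : M) :=
  {for p, continuous f} /\
  forall c c', atlas c -> atlas c' -> chart_dom c p -> chart_dom c' (f p) ->
    differentiable (c' \o f \o chart_inv c) (c p).

Lemma smooth_diff_at (R : realType) (M N : manifold R) (f : M -> N) p :
  smooth f -> diff_at f p.
Proof.
move=> [cf sf]; split; first exact: cf.
move=> c c' ac ac' dp dfp.
apply: (cont_diff_differentiable (sf c c' ac ac' 1)).
by exists p.
Qed.

(** The local expressions of the identity are the chart transitions, so changes of chart become
    instances of the chain rule for maps. *)
Lemma diff_at_id (R : realType) (M : manifold R) (p : M) :
  diff_at (fun q : M => q) p.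
Proof.
split; first exact: cvg_id.
move=> c c' ac ac' dp dp'.
apply: (cont_diff_differentiable (atlas_compatible ac ac' 1)).
by exists p.
Qed.

Lemma near_chart (R : realType) (M N : manifold R) (f : M -> N) (p : M)
    (c : chart R M (dim M)) (c' : chart R N (dim N)) :
  {for p, continuous f} -> chart_dom c p -> chart_dom c' (f p) ->
  \forall u \near c p, chart_dom c (chart_inv c u) /\
     chart_dom c' (f (chart_inv c u)).
Proof.
move=> cf dp dfp.
have icp := chart_im_map dp.
have n1 : nbhs (c p) (chart_im c).
  by apply: open_nbhs_nbhs; split => //; exact: chart_open_im.
have n3 : nbhs (f p) (chart_dom c').
  by apply: open_nbhs_nbhs; split => //; exact: chart_open.
have n2 : nbhs (c p) (fun u => chart_dom c' (f (chart_inv c u))).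
  have := chart_inv_cont icp; rewrite /prop_for /continuous_at chart_mapK // => h.
  exact: (h _ (cf _ n3)).
near=> u; split; last by near: u.
have iu : chart_im c u by near: u.
by have [] := chart_imP iu.
Unshelve. all: by end_near. Qed.

(** By continuity of f the intermediate chart c' cancels near c p, which leaves the chain rule in
    vector spaces. Taking f or g to be the identity gives the transformation of tangent vectors
    under a change of chart. *)
Lemma derive_chart_comp (R : realType) (M N P : manifold R) (f : M -> N)
    (g : N -> P) (p : M) (c : chart R M (dim M)) (c' : chart R N (dim N))
    (c'' : chart R P (dim P)) e :
  atlas c -> atlas c' -> atlas c'' ->
  diff_at f p -> diff_at g (f p) -> chart_dom c p -> chart_dom c' (f p) ->
  chart_dom c'' (g (f p)) ->
  'D_e (c'' \o (fun q => g (f q)) \o chart_inv c) (c p) =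
  'D_('D_e (c' \o f \o chart_inv c) (c p)) (c'' \o g \o chart_inv c') (c' (f p)).
Proof.
move=> ac ac' ac'' [cf df] [cg dg] dp dfp dgp.
have E : c' (f p) = (c' \o f \o chart_inv c) (c p) by rewrite /= chart_mapK.
have dgE := dg c' c'' ac' ac'' dfp dgp; rewrite E in dgE.
rewrite E -(derive_comp e (df c c' ac ac' dp dfp) dgE).
apply: near_eq_derive; near=> u; rewrite /= chart_mapK //.
have [] // : chart_dom c (chart_inv c u) /\ chart_dom c' (f (chart_inv c u)).
near: u; exact: near_chart.
Unshelve. all: by end_near. Qed.

Lemma tangent_map_comp (R : realType) (M N P : manifold R) (f : M -> N)
    (g : N -> P) (p : M) u : diff_at f p -> diff_at g (f p) ->
  tangent_map (fun q => g (f q)) p u = tangent_map g (f p) (tangent_map f p u).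
Proof.
move=> df dg; apply: derive_chart_comp => //;
  try exact: chart_at_atlas; exact: chart_at_dom.
Qed.

Lemma pull_comp (R : realType) (M N P : manifold R) (f : M -> N) (g : N -> P)
    (w : dform P) : (forall p, diff_at f p) -> (forall q, diff_at g q) ->
  pull f (pull g w) = pull (fun q => g (f q)) w.
Proof.
move=> df dg; apply/funext => p; apply/funext => s.
rewrite /pull -map_comp; congr (w _ _); apply: eq_map => u /=.
exact: esym (tangent_map_comp u (df p) (dg (f p))).
Qed.

Lemma tangent_map_linear (R : realType) (M N : manifold R) (f : M -> N) p a u v :
  diff_at f p ->
  tangent_map f p (a *: u + v) = a *: tangent_map f p u + tangent_map f p v.
Proof.
move=> [_ df]; apply: derive_dirP; apply: df;
  try exact: chart_at_atlas; exact: chart_at_dom.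
Qed.

Lemma alt_multilinear_map (R : realType) (V V' W : lmodType R) (f : seq V -> W)
    (g : V' -> V) : alt_multilinear f ->
  (forall a u v, g (a *: u + v) = a *: g u + g v) ->
  alt_multilinear (fun s => f (map g s)).
Proof.
move=> [fl f0] gl; split=> [s1 s2 a u v|s1 s2 s3 u].
  by rewrite !map_cat /= gl fl.
by rewrite !map_cat /= map_cat /= f0.
Qed.

Lemma alt_multilinear_form_in (R : realType) (M : manifold R)
    (c : chart R M (dim M)) (w : dform M) u :
  atlas c -> (forall p, alt_multilinear (w p)) -> chart_im c u ->
  alt_multilinear (form_in c w u).
Proof.
move=> ac wa iu; apply: alt_multilinear_map => // a v v'.
apply: derive_dirP.
have [dq E] := chart_imP iu.
rewrite -[X in differentiable _ X]E.
apply: (@diff_at_id _ _ (chart_inv c u)).2 => //.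
  exact: chart_at_atlas.
exact: chart_at_dom.
Qed.

(** Both sides evaluate w at the image of the point q with coordinates u. By [L] and [L'] the two
    routes for the arguments, through the preferred chart at q and through c', both end in the
    derivative of [chart_at (f q) \o f \o chart_inv c]. *)
Lemma form_in_pull (R : realType) (M N : manifold R) (f : M -> N)
    (c : chart R M (dim M)) (c' : chart R N (dim N)) (w : dform N) u s :
  atlas c -> atlas c' -> chart_im c u -> chart_dom c' (f (chart_inv c u)) ->
  diff_at f (chart_inv c u) ->
  form_in c (pull f w) u s =
  form_in c' w ((c' \o f \o chart_inv c) u)
    [seq 'D_e (c' \o f \o chart_inv c) u | e <- s].
Proof.
move=> ac ac' iu dfu df; have [dq E] := chart_imP iu.
set q := chart_inv c u in dfu df dq E *.
have L e : tangent_map f q ('D_e (chart_at q \o chart_inv c) u) =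
    'D_e (chart_at (f q) \o f \o chart_inv c) u.
  rewrite -E; apply: esym.
  exact: (derive_chart_comp e ac (chart_at_atlas q) (chart_at_atlas (f q))
    (diff_at_id q) df dq (chart_at_dom q) (chart_at_dom (f q))).
have L' e : 'D_('D_e (c' \o f \o chart_inv c) u)
      (chart_at (f q) \o chart_inv c') (c' (f q)) =
    'D_e (chart_at (f q) \o f \o chart_inv c) u.
  rewrite -E; apply: esym.
  exact: (derive_chart_comp e ac ac' (chart_at_atlas (f q)) df
    (diff_at_id (f q)) dq dfu (chart_at_dom (f q))).
rewrite /form_in [in RHS]/= -/q chart_mapK // /pull -!map_comp.
by apply: (congr1 (w (f q))); apply: eq_map => e; rewrite /= L L'.
Qed.

Lemma derive_chart_at (R : realType) (M : manifold R) (p : M) e :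
  'D_e (chart_at p \o chart_inv (chart_at p)) (chart_at p p) = e.
Proof.
rewrite -[RHS](derive_id (chart_at p p)).
apply: near_eq_derive.
have n1 : nbhs (chart_at p p) (chart_im (chart_at p)).
  apply: open_nbhs_nbhs; split; first exact: chart_open_im.
  exact/chart_im_map/chart_at_dom.
near=> u; rewrite /=.
have iu : chart_im (chart_at p) u by near: u.
by have [] := chart_imP iu.
Unshelve. all: by end_near. Qed.

Lemma form_in_chart_at (R : realType) (M : manifold R) (w : dform M) (p : M) s :
  form_in (chart_at p) w (chart_at p p) s = w p s.
Proof.
rewrite /form_in chart_mapK; last exact: chart_at_dom.
congr (w _ _); rewrite -[RHS]map_id; apply: eq_map => e.
exact: derive_chart_at.
Qed.

(* No degree condition, as the values of Cartan cochains are sums of forms of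
   different degrees. *)
Definition mixed_form (R : realType) (M : manifold R) (w : dform M) :=
  (forall p, alt_multilinear (w p)) /\
  forall c s, atlas c -> smooth_on (chart_im c) (fun u => form_in c w u s).

Lemma Omega_mixed (R : realType) (M : manifold R) k (w : dform M) :
  Omega k w -> mixed_form w.
Proof. by case. Qed.

Lemma chart_im_open (R : realType) (T : topologicalType) m (c : chart R T m) :
  open (chart_im c).
Proof. exact: chart_open_im. Qed.

Lemma mixed_form0 (R : realType) (M : manifold R) : mixed_form (0 : dform M).
Proof.
split=> [p|c s ac k]; first by split=> * //; rewrite scaler0 addr0.
exact: cont_diff_cst.
Qed.

Lemma mixed_formD (R : realType) (M : manifold R) (w w' : dform M) :
  mixed_form w -> mixed_form w' -> mixed_form (w + w').
Proof.
move=> [wa ws] [wa' ws']; split=> [p|c s ac k].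
  have [wl w0] := wa p; have [wl' w0'] := wa' p.
  split=> [s1 s2 a u v|s1 s2 s3 u].
    rewrite -[LHS]/(w p _ + w' p _) -[X in _ = _ *: X + _]/(w p _ + w' p _).
    rewrite -[X in _ = _ + X]/(w p _ + w' p _) wl wl' scalerDr.
    by rewrite addrACA.
  by rewrite -[LHS]/(w p _ + w' p _) w0 w0' addr0.
by apply: cont_diffD; [exact: chart_im_open|exact: ws|exact: ws'].
Qed.

Lemma mixed_form_sum (R : realType) (M : manifold R) (I : Type) (r : seq I)
    (P : pred I) (w : I -> dform M) :
  (forall i, P i -> mixed_form (w i)) -> mixed_form (\sum_(i <- r | P i) w i).
Proof.
move=> ws; elim/big_ind : _ => //; [exact: mixed_form0|exact: mixed_formD].
Qed.

Lemma mixed_formZ (R : realType) (M : manifold R) a (w : dform M) :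
  mixed_form w -> mixed_form (a *: (w : M -> seq (tangent M) -> R^o)).
Proof.
move=> [wa ws]; split=> [p|c s ac k].
  have [wl w0] := wa p; split=> [s1 s2 b u v|s1 s2 s3 u].
    rewrite -[LHS]/(a *: w p _) -[X in _ = _ *: X + _]/(a *: w p _).
    rewrite -[X in _ = _ + X]/(a *: w p _) wl scalerDr !scalerA.
    by rewrite [a * b]mulrC.
  by rewrite -[LHS]/(a *: w p _) w0 scaler0.
apply: cont_diffM; [exact: chart_im_open|exact: cont_diff_cst|exact: ws].
Qed.

Lemma mixed_pull (R : realType) (M N : manifold R) (f : M -> N) (w : dform N) :
  smooth f -> mixed_form w -> mixed_form (pull f w).
Proof.
move=> sf [wa ws]; split=> [p|c s ac k].
  apply: alt_multilinear_map => // a u v; apply: tangent_map_linear.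
  exact: smooth_diff_at.
(* The image of the domain of c need not lie in a single chart, so the target chart is chosen
   separately at each point. *)
apply: cont_diff_cover => u iu.
pose c' := chart_at (f (chart_inv c u)).
have ac' : atlas c' by exact: chart_at_atlas.
have oV := @local_dom_open _ _ _ _ _ c c' f sf.1; set V := (X in open X) in oV.
have Vu : V u by apply/local_domP; split => //; exact: chart_at_dom.
exists V => //.
set phi := c' \o f \o chart_inv c.
have sphi j : cont_diff j V phi by exact: sf.2.
have Vphi x : V x -> chart_im c' (phi x).
  by move=> /local_domP[ix dx]; exact: chart_im_map.
have := @cont_diff_alt_multilinear R k _ _ V
  (fun x => form_in c' w (phi x)) _ (fun e => 'D_e phi) s [::] oV.
move=> H; apply: cont_diff_eq (H _ _ _) => //.
- move=> x /local_domP[ix dx]; rewrite cats0 (@form_in_pull _ _ _ f c c') //.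
  exact: smooth_diff_at.
- by move=> x Vx; apply: alt_multilinear_form_in => //; exact: Vphi.
- move=> t; apply: cont_diff_comp (sphi k) (ws c' t ac' k) => //.
- by move=> e; apply: cont_diff_derive.
Qed.

Lemma Omega_pull (R : realType) (M N : manifold R) (f : M -> N) k (w : dform N) :
  smooth f -> Omega k w -> Omega k (pull f w).
Proof.
move=> sf ow; have [? ?] := mixed_pull sf (Omega_mixed ow).
by case: ow => o1 _ _; split=> // p s sk; apply: o1; rewrite size_map.
Qed.

(** * Naturality of the exterior and Lie derivatives *)

(** The product rule for the coefficients of w along phi with arguments ['D_e phi]. It serves both
    derivatives: v is one of the arguments in [ext_d] and the value of the field in [lie_der]. *)
Lemma derive_form_in_pull (R : realType) (M N : manifold R) (f : M -> N)
    (w : dform N) (p : M) (v : tangent M) (s : seq (tangent M)) :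
  smooth f -> mixed_form w ->
  let phi := chart_at (f p) \o f \o chart_inv (chart_at p) in
  let s' := [seq tangent_map f p e | e <- s] in
  'D_v (fun u => form_in (chart_at p) (pull f w) u s) (chart_at p p) =
  'D_(tangent_map f p v) (fun y => form_in (chart_at (f p)) w y s')
    (chart_at (f p) (f p)) +
  \sum_(q < size s)
    w (f p) (replace q ('D_v ('D_(nth 0 s q) phi) (chart_at p p)) s').
Proof.
move=> sf [wa ws] phi s'.
set c := chart_at p; set c' := chart_at (f p).
have ac : atlas c by exact: chart_at_atlas.
have ac' : atlas c' by exact: chart_at_atlas.
have dp : chart_dom c p by exact: chart_at_dom.
have dfp : chart_dom c' (f p) by exact: chart_at_dom.
have oV := @local_dom_open _ _ _ _ _ c c' f sf.1; set V := (X in open X) in oV.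
have Vp : V (c p) by exists p.
have sphi j : cont_diff j V phi by exact: sf.2.
have Vphi x : V x -> chart_im c' (phi x).
  by move=> /local_domP[ix dx]; exact: chart_im_map.
have phip : phi (c p) = c' (f p) by rewrite /phi /= chart_mapK.
have nV : nbhs (c p) V by exact: open_nbhs_nbhs.
have -> : 'D_v (fun u => form_in c (pull f w) u s) (c p) =
    'D_v (fun u => form_in c' w (phi u) ([seq 'D_e phi u | e <- s] ++ [::])) (c p).
  apply: near_eq_derive; near=> u.
  have /local_domP[iu du] : V u by near: u.
  rewrite cats0 (@form_in_pull _ _ _ f c c') //.
  exact: smooth_diff_at.
have sK t : cont_diff 1 V (fun u => form_in c' w (phi u) t).
  by apply: cont_diff_comp (sphi 1%N) (ws c' t ac' 1%N).
rewrite (@derive_alt_multilinear R _ _ V (fun u => form_in c' w (phi u)) _ 0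
  (fun e => 'D_e phi) s [::] (c p) v oV Vp) //; last 2 first.
- by move=> u Vu; apply: alt_multilinear_form_in => //; exact: Vphi.
- by move=> e; apply: cont_diff_derive.
have -> : [seq 'D_e phi (c p) | e <- s] ++ [::] = s' by rewrite cats0.
have dphi : differentiable phi (c p).
  exact: cont_diff_differentiable (sphi 1%N) Vp.
have dw : differentiable (fun y => form_in c' w y s') (phi (c p)).
  exact: cont_diff_differentiable (ws c' s' ac' 1%N) (Vphi _ Vp).
have E1 := derive_comp v dphi dw.
rewrite phip in E1; apply: congr2; first exact: E1.
by apply: eq_bigr => q _; rewrite phip form_in_chart_at.
Unshelve. all: by end_near. Qed.

(** Exchanging the indices gives S + S = 0, and a [numDomainType] has no 2-torsion. *)
Lemma sum_antisym (R : numDomainType) n (T : 'I_n -> 'I_n -> R) :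
  (forall i j, T i j = - T j i) -> \sum_i \sum_j T i j = 0.
Proof.
move=> TN; set S := LHS; apply/eqP; rewrite -[_ == 0](mulrn_eq0 S 2) mulr2n.
by rewrite {2}/S exchange_big /= -big_split big1 //= => i _;
  rewrite -big_split big1 //= => j _; rewrite (TN i j) addNr.
Qed.

(* Second derivatives are symmetric in the two directions, whereas the signs
   produced by removing i and filling slot j are antisymmetric. *)
Lemma sum_rem_replace (R : realType) (V : lmodType R) (L : seq V -> R^o)
    (t : seq V) (b : nat -> nat -> V) :
  alt_multilinear L -> (forall i j, b i j = b j i) ->
  \sum_(i < size t) (-1) ^+ i *
    \sum_(q < (size t).-1) L (replace q (b i (bump i q)) (rem_at i t)) = 0 :> R.
Proof.
move=> La bC; case E : (size t) => [|n] /=; first by rewrite big_ord0.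
(* The pair (i, q) is re-indexed by the position j = [bump i q] in the full list, which runs over
   all indices other than i; the diagonal is filled with 0. *)
pose T (i j : 'I_n.+1) : R := if j == i then 0 else
  (-1) ^+ i * L (replace (unbump i j) (b i j) (rem_at i t)).
transitivity (\sum_i \sum_j T i j).
  apply: eq_bigr => i _; rewrite (bigD1_ord i) //= {1}/T eqxx add0r mulr_sumr.
  apply: eq_bigr => q _; rewrite /T.
  by rewrite eq_sym (negbTE (neq_lift _ _)) /= bumpK.
apply: sum_antisym => i j; wlog ij : i j / (i < j)%N.
  move=> H; have [ij|ji|ij] := ltngtP i j; first exact: H.
    by rewrite (H j i) // opprK.
  by rewrite (ord_inj ij) /T eqxx oppr0.
have ji : (j == i) = false by apply/negbTE; rewrite -val_eqE /=; lia.
rewrite /T ji [i == j]eq_sym ji bC.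
have -> : unbump i j = j.-1 by rewrite /unbump ij subn1.
have -> : unbump j i = i by rewrite /unbump ltnNge (ltnW ij) subn0.
have jE : (j.-1.+1 = j)%N by lia.
have ij' : (i <= j.-1)%N by lia.
have jt : (j.-1.+1 < size t)%N by rewrite jE E.
by have := alt_multilinear_rem_antisym (b j i) La ij' jt; rewrite jE.
Qed.

Lemma map_rem_at (T T' : Type) (f : T -> T') i (s : seq T) :
  [seq f x | x <- rem_at i s] = rem_at i [seq f x | x <- s].
Proof. by rewrite /rem_at map_cat map_take map_drop. Qed.

Lemma pull_ext_d (R : realType) (M N : manifold R) (f : M -> N) (w : dform N) :
  smooth f -> mixed_form w -> pull f (ext_d w) = ext_d (pull f w).
Proof.
move=> sf mw; apply/funext => p; apply/funext => s.
rewrite /pull /ext_d -/(pull f w).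
set phi := chart_at (f p) \o f \o chart_inv (chart_at p).
set s' := [seq tangent_map f p e | e <- s].
under [RHS]eq_bigr => i _ do rewrite derive_form_in_pull // mulrDr.
rewrite big_split /= -/phi.
have ss' : size s' = size s by rewrite size_map.
rewrite [X in _ = _ + X](_ : _ = 0) ?addr0.
  rewrite ss'; apply: eq_bigr => i _.
  by rewrite -(nth_map 0 0 (tangent_map f p)) // -/s' map_rem_at.
(* Slot q of [rem_at i s] holds the entry of s at position [bump i q], so the remainder is the
   vanishing sum with b the symmetric array of second derivatives. *)
pose b i j := 'D_(nth 0 s i) ('D_(nth 0 s j) phi) (chart_at p p).
rewrite -[RHS](@sum_rem_replace R _ (w (f p)) s' b (mw.1 (f p))) => [|i j].
  rewrite ss'; apply: eq_bigr => i _.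
  have sr : size (rem_at i s) = (size s).-1.
    rewrite size_cat size_take size_drop ltn_ord.
    by have := ltn_ord i; lia.
  rewrite sr; congr (_ * _); apply: eq_bigr => q _.
  rewrite map_rem_at -/s' /b (_ : nth 0 (rem_at i s) q = nth 0 s (bump i q)) //.
  rewrite /rem_at nth_cat size_take ltn_ord /bump.
  case: ltnP => qi; first by rewrite nth_take // add0n.
  by rewrite nth_drop; congr (nth 0 s _); lia.
have [sc sl] := sf.
have oV := @local_dom_open _ _ _ _ _ (chart_at p) (chart_at (f p)) f sc.
have Vp : [set chart_at p x | x in chart_dom (chart_at p) `&`
    f @^-1` chart_dom (chart_at (f p))] (chart_at p p).
  by exists p => //; split; exact: chart_at_dom.
have sphi := sl _ _ (chart_at_atlas p) (chart_at_atlas (f p)) 2%N.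
exact: (derive_sym_rV (nth 0 s j) (nth 0 s i) oV Vp sphi).
Qed.

Lemma pull_contract (R : realType) (M N : manifold R) (f : M -> N)
    (X : vfield N) (X' : vfield M) (w : dform N) :
  (forall p, tangent_map f p (X' p) = X (f p)) ->
  pull f (contract X w) = contract X' (pull f w).
Proof.
move=> rel; apply/funext => p; apply/funext => s.
by rewrite /pull /contract /= rel.
Qed.

(** The product rule for the coordinates of Y and the partial derivatives of f; symmetry of second
    derivatives then makes v the inner direction in the last term. *)
Lemma derive_derive_along (R : realType) n (f : 'rV[R]_n -> R^o)
    (Y : 'rV[R]_n -> 'rV[R]_n) (U : set 'rV[R]_n) x v :
  open U -> U x -> cont_diff 2 U f -> differentiable Y x ->
  'D_v (fun u => 'D_(Y u) f u) x = 'D_('D_v Y x) f x + 'D_(Y x) ('D_v f) x.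
Proof.
move=> oU Ux sf dY.
have nU : nbhs x U by exact: open_nbhs_nbhs.
have df u : U u -> differentiable f u by exact: cont_diff_differentiable sf.
have dDf e : differentiable ('D_e f) x.
  exact: cont_diff_differentiable (cont_diff_derive e sf) Ux.
transitivity ('D_v (fun u => \sum_(j < n) (Y u 0 j * 'D_(delta_mx 0 j) f u : R^o)) x).
  apply: near_eq_derive; near=> u; apply: derive_row_expand; apply: df.
  by near: u.
have dYj j : differentiable (fun u => Y u 0 j : R^o) x.
  exact: differentiable_rV_coord.
rewrite derive_big; last first.
  by move=> j; apply: differentiableM; [exact: dYj|exact: dDf].
rewrite (derive_row_expand _ (df _ Ux)) (derive_row_expand _ (dDf v)).
rewrite -big_split; apply: eq_bigr => j _ /=.
rewrite (derive_mul v (dYj j) (dDf _)) (derive_coord v j dY) addrC.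
by rewrite (derive_sym (delta_mx 0 j) v oU Ux sf).
Unshelve. all: by end_near. Qed.

(** Matches what [lie_der] takes from X at p: first derivatives of its coordinates in the preferred
    chart, at the base point. *)
Definition vf_diff_at (R : realType) (M : manifold R) (X : vfield M) (p : M) :=
  differentiable (vfield_in (chart_at p) X) (chart_at p p).

(** Both sides equal the derivative along X' q of [c' \o f \o chart_inv (chart_at q)], factored once
    through c and once through the preferred chart at f q. *)
Lemma vfield_in_related (R : realType) (M N : manifold R) (f : M -> N)
    (X : vfield N) (X' : vfield M) (c : chart R M (dim M))
    (c' : chart R N (dim N)) u :
  (forall p, tangent_map f p (X' p) = X (f p)) -> smooth f ->
  atlas c -> atlas c' -> chart_im c u -> chart_dom c' (f (chart_inv c u)) ->
  'D_(vfield_in c X' u) (c' \o f \o chart_inv c) u =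
  vfield_in c' X ((c' \o f \o chart_inv c) u).
Proof.
move=> rel sf ac ac' iu dfu; have [dq E] := chart_imP iu.
rewrite /vfield_in /=; set q := chart_inv c u in dfu dq E *.
rewrite chart_mapK // -rel.
have dq_ := chart_at_dom q; have dfq := chart_at_dom (f q).
have aq := chart_at_atlas q; have afq := chart_at_atlas (f q).
have df : diff_at f q by exact: smooth_diff_at.
have := derive_chart_comp (X' q) aq ac ac' (diff_at_id q) df dq_ dq dfu.
rewrite E => <-.
exact: (derive_chart_comp (X' q) aq afq ac' df (diff_at_id (f q)) dq_ dfq dfu).
Qed.

Lemma vfield_in_chart_at (R : realType) (M : manifold R) (X : vfield M) (p : M) :
  vfield_in (chart_at p) X (chart_at p p) = X p.
Proof.
rewrite /vfield_in chart_mapK; last exact: chart_at_dom.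
exact: derive_chart_at.
Qed.

(** The identity [vfield_in_related] is differentiated along e, with the chain rule on the side of X
    and [derive_derive_along] on the side of X'. This goes coordinate by coordinate, the latter
    being a statement about scalar functions. *)
Lemma derive_vfield_in_related (R : realType) (M N : manifold R) (f : M -> N)
    (X : vfield N) (X' : vfield M) p e :
  (forall p, tangent_map f p (X' p) = X (f p)) -> smooth f ->
  vf_diff_at X (f p) -> vf_diff_at X' p ->
  'D_(tangent_map f p e) (vfield_in (chart_at (f p)) X) (chart_at (f p) (f p)) =
  tangent_map f p ('D_e (vfield_in (chart_at p) X') (chart_at p p)) +
  'D_(X' p) ('D_e (chart_at (f p) \o f \o chart_inv (chart_at p))) (chart_at p p).
Proof.
move=> rel sf dX dX'.
set c := chart_at p; set c' := chart_at (f p); set phi := c' \o f \o chart_inv c.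
have ac : atlas c by exact: chart_at_atlas.
have ac' : atlas c' by exact: chart_at_atlas.
have dp : chart_dom c p by exact: chart_at_dom.
have oV := @local_dom_open _ _ _ _ _ c c' f sf.1; set V := (X in open X) in oV.
have Vp : V (c p) by exists p => //; split => //; exact: chart_at_dom.
have sphi j : cont_diff j V phi by exact: sf.2.
have phip : phi (c p) = c' (f p) by rewrite /phi /= chart_mapK.
have nV : nbhs (c p) V by exact: open_nbhs_nbhs.
have dphi x : V x -> differentiable phi x.
  exact: cont_diff_differentiable (sphi 1%N).
have dXphi : differentiable (vfield_in c' X) (phi (c p)) by rewrite phip.
have := derive_comp e (dphi _ Vp) dXphi; rewrite phip => <-.
apply/rowP => j.
have dXc : differentiable (vfield_in c' X \o phi) (c p).
  exact: differentiable_comp (dphi _ Vp) dXphi.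
rewrite -(derive_coord e j dXc) mxE.
transitivity ('D_e (fun u => 'D_(vfield_in c X' u) (fun y => phi y 0 j : R^o) u) (c p)).
  apply: near_eq_derive; near=> u.
  have Vu : V u by near: u.
  have [iu du] := (local_domP c c' f u).1 Vu.
  by rewrite (derive_coord _ _ (dphi _ Vu)) (vfield_in_related rel sf ac ac' iu du).
rewrite (derive_derive_along e oV Vp (cont_diff_coord j oV (sphi 2%N)) dX').
rewrite (derive_coord _ _ (dphi _ Vp)) vfield_in_chart_at; congr (_ + _).
have dDphi : differentiable ('D_e phi) (c p).
  exact: cont_diff_differentiable (cont_diff_derive e (sphi 2%N)) Vp.
rewrite -(derive_coord _ _ dDphi).
apply: near_eq_derive; near=> u.
by apply: derive_coord; apply: dphi; near: u.
Unshelve. all: by end_near. Qed.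

Lemma set_nth_replace (T : Type) (x0 : T) s q y : (q < size s)%N ->
  set_nth x0 s q y = replace q y s.
Proof. by move=> qs; rewrite set_nthE qs. Qed.

Lemma pull_lie_der (R : realType) (M N : manifold R) (f : M -> N)
    (X : vfield N) (X' : vfield M) (w : dform N) :
  (forall p, tangent_map f p (X' p) = X (f p)) -> smooth f -> mixed_form w ->
  (forall p, vf_diff_at X p) -> (forall p, vf_diff_at X' p) ->
  pull f (lie_der X w) = lie_der X' (pull f w).
Proof.
move=> rel sf mw dX dX'; apply/funext => p; apply/funext => s.
rewrite /pull /lie_der -/(pull f w) derive_form_in_pull // rel -addrA.
congr (_ + _); rewrite size_map -big_split; apply: eq_bigr => q _ /=.
set s' := [seq tangent_map f p e | e <- s].
have qs' : (q < size s')%N by rewrite size_map.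
rewrite (nth_map 0) // !set_nth_replace //.
(* Slot by slot, the second-derivative term that appears here is the remainder left by
   [derive_form_in_pull]. *)
rewrite (derive_vfield_in_related _ rel sf (dX _) (dX' p)).
rewrite /replace map_cat map_take /= map_drop -/s' -[X in X + _]scale1r.
by rewrite (mw.1 (f p)).1 scale1r addrC.
Qed.

(** * Fundamental vector fields *)

(* If no one-parameter subgroup existed, [exp_curve x] would be the constant
   curve, which has the same two properties; so the existence theorem for ODEs
   is not needed. *)
Lemma exp_curveP (R : realType) (G : lieGroup R) (x : lieAlg G) :
  exp_curve x 0 = lg_one G /\ smooth_curve (exp_curve x).
Proof.
rewrite /exp_curve; case: xgetP => [gam _ [sg gD _]|_].
  split=> //; have := gD 0 0; rewrite addr0 => /(congr1 (lg_mul (lg_inv (gam 0)))).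
  by rewrite lg_mulA lg_mulV lg_mul1.
split=> //; split; first by move=> t; exact: cvg_cst.
by move=> c ac k; exact: cont_diff_cst.
Qed.

(** On a singleton, [cont_diff] records continuity and differentiability at that point of the map
    and its iterated directional derivatives. The order k is free because partial derivatives of the
    action are differentiated as well. *)
Lemma act_chart_differentiable (R : realType) (G : lieGroup R) (M : manifold R)
    (a : lie_action G M) (g : G) (p : M) (cg : chart R G (dim G))
    (c c' : chart R M (dim M)) k :
  atlas cg -> atlas c -> atlas c' -> chart_dom cg g -> chart_dom c p ->
  chart_dom c' (a g p) ->
  cont_diff k [set (cg g, c p)]
    (fun w => c' (a (chart_inv cg w.1) (chart_inv c w.2))).
Proof.
move=> acg ac ac' dg dp dgp.
have [_ /(_ cg c c' acg ac ac' k)] := act_smooth a.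
apply: cont_diff_mono => _ -> /=.
by split; [exact: chart_im_map|exact: chart_im_map|rewrite !chart_mapK].
Qed.

Lemma act_diff_at (R : realType) (G : lieGroup R) (M : manifold R)
    (a : lie_action G M) (g : G) (p : M) : diff_at (a g) p.
Proof.
have [ca _] := act_smooth a; split.
  apply: (@continuous_comp _ _ _ (fun q : M => (g, q)) (fun z : G * M => a z.1 z.2)).
    by apply: cvg_pair; [exact: cvg_cst|exact: cvg_id].
  exact: ca.
move=> c c' ac ac' dp dgp.
have dg := chart_at_dom g.
have sH := act_chart_differentiable 1 (chart_at_atlas g) ac ac' dg dp dgp.
have dH := cont_diff_differentiable sH (erefl _).
have dP : differentiable (fun u : 'rV[R]_(dim M) => (chart_at g g, u)) (c p).
  by apply: differentiable_pair; [exact: differentiable_cst|].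
have := differentiable_comp dP dH.
by congr (differentiable _ _); apply/funext => u /=; rewrite chart_mapK.
Qed.

(** The analogue of [derive_chart_comp] for a curve. With f the identity it changes the chart in
    which a velocity is read; with f equivariant it relates fundamental fields. *)
Lemma derive_chart_curve (R : realType) (M N : manifold R) (f : M -> N)
    (gam : R^o -> M) (c : chart R M (dim M)) (c' : chart R N (dim N)) (p : M) :
  gam 0 = p -> {for 0, continuous gam} -> atlas c -> atlas c' ->
  chart_dom c p -> chart_dom c' (f p) -> diff_at f p ->
  differentiable (c \o gam) 0 ->
  'D_1 (c' \o (fun t => f (gam t))) 0 =
  'D_('D_1 (c \o gam) 0) (c' \o f \o chart_inv c) (c p).
Proof.
move=> g0 cg ac ac' dp dfp [cf df] dg.
have E : c p = (c \o gam) 0 by rewrite /= g0.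
have d2 := df c c' ac ac' dp dfp; rewrite E in d2.
rewrite E -(derive_comp (1 : R^o) dg d2); apply: near_eq_derive.
have n1 : nbhs (gam 0) (chart_dom c).
  by rewrite g0; apply: open_nbhs_nbhs; split => //; exact: chart_open.
have n2 := cg _ n1.
near=> t; rewrite /= chart_mapK //; near: t; exact: n2.
Unshelve. all: by end_near. Qed.

Section flow.
Context (R : realType) (G : lieGroup R) (M : manifold R) (a : lie_action G M).
Context (x : lieAlg G).

Let e := lg_one G.
Let cg := chart_at e.
Let gam (p : M) (t : R^o) := a (exp_curve x (- t)) p.
Let y := 'D_1 (fun t : R^o => cg (exp_curve x (- t))) 0.

Lemma exp_opp_continuous : {for 0, continuous (fun t : R^o => exp_curve x (- t))}.
Proof.
apply: (@continuous_comp _ _ _ (fun t : R^o => - t) (exp_curve x)).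
  exact: opp_continuous.
exact: (exp_curveP x).2.1.
Qed.

Lemma flow0 p : gam p 0 = p.
Proof. by rewrite /gam oppr0 (exp_curveP x).1 act1. Qed.

Lemma flow_continuous p : {for 0, continuous (gam p)}.
Proof.
have [ca _] := act_smooth a.
apply: (@continuous_comp _ _ _ (fun t : R^o => (exp_curve x (- t), p))
  (fun z : G * M => a z.1 z.2)); last exact: ca.
by apply: cvg_pair; [exact: exp_opp_continuous|exact: cvg_cst].
Qed.

(** The orbit curve is the local expression of the action along t |-> (beta t, c p), whose velocity
    is (y, 0). As y does not depend on p, the velocity of the orbit is a fixed partial derivative of
    the action, evaluated at p. *)
Lemma derive_flow (c : chart R M (dim M)) p : atlas c -> chart_dom c p ->
  differentiable (c \o gam p) 0 /\
  'D_1 (c \o gam p) 0 =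
  'D_(y, 0) (fun w => c (a (chart_inv cg w.1) (chart_inv c w.2))) (cg e, c p).
Proof.
move=> ac dp.
have [e0 [ce se]] := exp_curveP x.
have de : chart_dom cg e by exact: chart_at_dom.
have acg : atlas cg by exact: chart_at_atlas.
have dep : chart_dom c (a e p) by rewrite act1.
have dH := cont_diff_differentiable
  (act_chart_differentiable 1 acg ac ac de dp dep) (erefl _).
set H := (fun w => _) in dH *.
pose beta (t : R^o) := cg (exp_curve x (- t)).
have db : differentiable beta 0.
  apply: (@differentiable_comp _ _ _ _ (fun t : R^o => - t) (cg \o exp_curve x)).
    exact: (@differentiableN _ _ _ id).
  rewrite oppr0; apply: (cont_diff_differentiable (se cg acg 1%N)).
  by rewrite /= e0.
have dP : differentiable (fun t => (beta t, c p)) 0.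
  by apply: differentiable_pair => //; exact: differentiable_cst.
have b0 : beta 0 = cg e by rewrite /beta oppr0 e0.
have DP : 'D_1 (fun t => (beta t, c p)) 0 = (y, 0).
  rewrite deriveE // diff_pair //.
  by rewrite -[X in (X, _)]deriveE // diff_cst.
rewrite -b0 in dH; rewrite -b0 -DP.
have cb : nbhs (0 : R^o) (fun t : R^o => chart_dom cg (exp_curve x (- t))).
  apply: exp_opp_continuous; rewrite oppr0 e0.
  by apply: open_nbhs_nbhs; split => //; exact: chart_open.
have near_ : {near (0 : R^o), H \o (fun t => (beta t, c p)) =1 c \o gam p}.
  near=> t; by rewrite /H /beta /= !chart_mapK //; near: t.
split; first exact: near_eq_differentiable near_ (differentiable_comp dP dH).
rewrite -(derive_comp (1 : R^o) dP dH); apply: near_eq_derive.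
near=> t; apply/esym; near: t; exact: near_.
Unshelve. all: by end_near. Qed.

(** [velocity] reads the curve in the preferred chart of its point at time 0, which has to be
    identified with p. *)
Lemma velocity_flow p : fund a x p = 'D_1 (chart_at p \o gam p) 0.
Proof.
by have g0 := flow0 p; rewrite /gam in g0; rewrite /fund /velocity /= g0.
Qed.

Lemma fund_vf_diff_at p : vf_diff_at (fund a x) p.
Proof.
rewrite /vf_diff_at; set c := chart_at p.
have ac : atlas c by exact: chart_at_atlas.
have dp : chart_dom c p by exact: chart_at_dom.
have de : chart_dom cg e by exact: chart_at_dom.
have acg : atlas cg by exact: chart_at_atlas.
have dep : chart_dom c (a e p) by rewrite act1.
(* Order 2: one derivative is spent on the velocity, and one remains for differentiability in p. *)
have sH := cont_diff_derive (y, 0) (act_chart_differentiable 2 acg ac ac de dp dep).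
have dH := cont_diff_differentiable sH (erefl _).
set H := (fun w => c _) in dH.
have dP : differentiable (fun u : 'rV[R]_(dim M) => (cg e, u)) (c p).
  by apply: differentiable_pair; [exact: differentiable_cst|].
apply: near_eq_differentiable (differentiable_comp dP dH).
have n1 : nbhs (c p) (chart_im c).
  by apply: open_nbhs_nbhs; split; [exact: chart_im_open|exact: chart_im_map].
near=> u.
have iu : chart_im c u by near: u.
have [dq E] := chart_imP iu.
rewrite /vfield_in velocity_flow /=; set q := chart_inv c u in dq E *.
have [dg _] := derive_flow (chart_at_atlas q) (chart_at_dom q).
have [_ Dg] := derive_flow ac dq.
(* The fundamental field at q is expressed in the preferred chart of q; this converts it to the
   fixed chart c. *)
have := derive_chart_curve (flow0 q) (@flow_continuous q) (chart_at_atlas q) ac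
  (chart_at_dom q) dq (diff_at_id q) dg.
by rewrite -[X in (cg e, X)]E -Dg => <-.
Unshelve. all: by end_near. Qed.

End flow.

(** Equivariance makes f carry the orbit curve of p to that of f p, so the chain rule along this
    curve gives the claim. *)
Lemma fund_related (R : realType) (G : lieGroup R) (M N : manifold R)
    (aM : lie_action G M) (aN : lie_action G N) (f : M -> N) (x : lieAlg G) p :
  smooth f -> equivariant aM aN f ->
  tangent_map f p (fund aM x p) = fund aN x (f p).
Proof.
move=> sf ef; rewrite !velocity_flow.
have [dg _] := derive_flow aM x (chart_at_atlas p) (chart_at_dom p).
have := derive_chart_curve (flow0 aM x p) (@flow_continuous _ _ _ aM x p)
  (chart_at_atlas p) (chart_at_atlas (f p)) (chart_at_dom p)
  (chart_at_dom (f p)) (smooth_diff_at p sf) dg.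
have -> : (fun t : R^o => f (aM (exp_curve x (- t)) p)) =
    (fun t => aN (exp_curve x (- t)) (f p)) by apply/funext => t; exact: ef.
exact: esym.
Qed.

Lemma pull_act (R : realType) (G : lieGroup R) (M N : manifold R)
    (aM : lie_action G M) (aN : lie_action G N) (f : M -> N) g (w : dform N) :
  smooth f -> equivariant aM aN f ->
  pull (aM g) (pull f w) = pull f (pull (aN g) w).
Proof.
move=> sf ef; have df p := smooth_diff_at p sf.
rewrite (pull_comp w (act_diff_at aM g) df) (pull_comp w df (act_diff_at aN g)).
by congr (pull _ w); apply/funext => p; rewrite ef.
Qed.

(** * Linear maps of values and maps of mapping cones *)

Lemma pull_linear (R : realType) (M N : manifold R) (f : M -> N) (a : R)
    (u v : N -> seq (tangent N) -> R^o) :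
  pull f (a *: u + v) = a *: (pull f u : M -> seq (tangent M) -> R^o) + pull f v.
Proof. by []. Qed.

Lemma ext_d0 (R : realType) (M : manifold R) : ext_d (0 : dform M) = 0.
Proof.
apply/funext => p; apply/funext => s; rewrite /ext_d big1 // => i _.
by rewrite (@derive_cst R _ R^o (0 : R^o)) mulr0.
Qed.

Lemma linear_map0 (R : realType) (V W : lmodType R) (f : V -> W) :
  (forall a u v, f (a *: u + v) = a *: f u + f v) -> f 0 = 0.
Proof. by move=> fl; have := fl (-1) 0 0; rewrite scaler0 addr0 scaleN1r addNr. Qed.

Lemma linear_map_sum (R : realType) (V W : lmodType R) (f : V -> W) (I : Type)
    (r : seq I) (P : pred I) (a : I -> R) (u : I -> V) :
  (forall a u v, f (a *: u + v) = a *: f u + f v) ->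
  f (\sum_(i <- r | P i) a i *: u i) = \sum_(i <- r | P i) a i *: f (u i).
Proof.
move=> fl; have f0 := linear_map0 fl.
by elim/big_rec2 : _ => // i _ v _ <-; rewrite fl.
Qed.

(** [delta_CE] rearranges and brackets arguments and combines the values linearly, so it commutes
    with every linear map of the values. *)
Lemma delta_CE_map (R : realType) (G : lieGroup R) (W W' : lmodType R)
    (f : W -> W') (c : seq (lieAlg G) -> W) xs :
  (forall a u v, f (a *: u + v) = a *: f u + f v) ->
  delta_CE (fun xs => f (c xs)) xs = f (delta_CE c xs).
Proof.
move=> fl; have f0 := linear_map0 fl.
have fD u v : f (u + v) = f u + f v by have := fl 1 u v; rewrite !scale1r.
rewrite /delta_CE (big_morph f fD f0); apply: eq_bigr => j _.
by rewrite linear_map_sum.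
Qed.

(** One statement for relative forms, the Chevalley-Eilenberg-de Rham complex and the Cartan model.
    The values of dB and dB' at 0 enter because in degree 0 the second component is 0 and comes with
    no membership in some [B_ k]. *)
Lemma cone_cochain_map (R : realType) (A B A' B' : lmodType R)
    (A_ : nat -> set A) (B_ : nat -> set B) (A'_ : nat -> set A')
    (B'_ : nat -> set B') (dA : A -> A) (dB : B -> B) (dA' : A' -> A')
    (dB' : B' -> B') (F : A -> B) (F' : A' -> B') (f : A -> A') (g : B -> B') :
  (forall a u v, f (a *: u + v) = a *: f u + f v) ->
  (forall a u v, g (a *: u + v) = a *: g u + g v) ->
  (forall k u, A_ k u -> A'_ k (f u)) -> (forall k u, B_ k u -> B'_ k (g u)) ->
  (forall k u, A_ k u -> dA' (f u) = f (dA u)) ->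
  (forall k u, B_ k u -> dB' (g u) = g (dB u)) -> dB 0 = 0 -> dB' 0 = 0 ->
  (forall u, F' (f u) = g (F u)) ->
  @cochain_map R (A * B)%type (A' * B')%type
    (cone_deg A_ B_) (cone_d dA dB F) (cone_deg A'_ B'_) (cone_d dA' dB' F')
    (fun ab => (f ab.1, g ab.2)).
Proof.
move=> fl gl fA gB fd gd d0 d0' FF k.
have g0 := linear_map0 gl.
have gB' u v : g (u - v) = g u - g v.
  by have := gl (-1) v u; rewrite !scaleN1r addrC [RHS]addrC.
split.
- move=> [u v] [/= Au Bv]; split=> /=; first exact: fA.
  by case: k Bv {Au} => [->|k /gB].
- by move=> a [u v] [u' v'] _ _ /=; rewrite fl gl.
- move=> [u v] [/= Au Bv]; rewrite /cone_d /= (fd _ _ Au) FF gB'.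
  congr (_, _ - _); case: k Bv {Au} => [->|k /gd //].
  by rewrite d0 g0 d0'.
Qed.

(** * Relative complexes *)

Lemma pull_pull_comm (R : realType) (N M N' M' : manifold R)
    (F : M -> N) (F' : M' -> N') (phiN : N' -> N) (phiM : M' -> M) (w : dform N) :
  smooth F -> smooth F' -> smooth phiN -> smooth phiM ->
  (forall p, F (phiM p) = phiN (F' p)) ->
  pull F' (pull phiN w) = pull phiM (pull F w).
Proof.
move=> sF sF' sN sM FF.
rewrite (pull_comp w (fun p => smooth_diff_at p sF') (fun p => smooth_diff_at p sN)).
rewrite (pull_comp w (fun p => smooth_diff_at p sM) (fun p => smooth_diff_at p sF)).
by congr (pull _ w); apply/funext => p; rewrite FF.
Qed.

Lemma rpull_linear (R : realType) (N M N' M' : manifold R)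
    (phiN : N' -> N) (phiM : M' -> M) (a : R) (u v : rform N M) :
  rpull phiN phiM (a *: u + v) = a *: rpull phiN phiM u + rpull phiN phiM v.
Proof.
case: u v => u1 u2 [v1 v2].
by rewrite /rpull /= (pull_linear phiN a u1 v1) (pull_linear phiM a u2 v2).
Qed.

Lemma rpullN (R : realType) (N M N' M' : manifold R)
    (phiN : N' -> N) (phiM : M' -> M) (u : rform N M) :
  rpull phiN phiM (- u) = - rpull phiN phiM u.
Proof.
have r0 := linear_map0 (rpull_linear phiN phiM).
by have := rpull_linear phiN phiM (-1) u 0; rewrite r0 !addr0 !scaleN1r.
Qed.

Lemma poly_form_mixed (R : realType) (G : lieGroup R) (P : manifold R) p q
    (alpha : cartan_cochain G P) x : poly_form p q alpha -> mixed_form (alpha x).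
Proof.
move=> [c [oc ->]]; apply: mixed_form_sum => m _.
exact/mixed_formZ/Omega_mixed/oc.
Qed.

Lemma cartan_deg_mixed (R : realType) (G : lieGroup R) (P : manifold R)
    (a : lie_action G P) k (alpha : cartan_cochain G P) x :
  cartan_deg a k alpha -> mixed_form (alpha x).
Proof.
move=> [c [ic ->]]; rewrite fct_sumE; apply: mixed_form_sum => p pk.
by have [pf _] := ic p pk; exact: poly_form_mixed pf.
Qed.

(** * Pullback along one equivariant map *)

Section pullback_one.
Context (R : realType) (G : lieGroup R) (P Q : manifold R) (f : P -> Q).
Context (aP : lie_action G P) (aQ : lie_action G Q).
Hypothesis (sf : smooth f) (ef : equivariant aP aQ f).

Lemma val_pull_poly_form p q (alpha : cartan_cochain G Q) :
  poly_form p q alpha -> poly_form p q (val_pull f alpha).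
Proof.
move=> [c [oc E]]; exists (fun m => pull f (c m)); split=> [m|x].
  exact: Omega_pull.
by rewrite /val_pull E linear_map_sum.
Qed.

Lemma val_pull_inv_poly_form p q (alpha : cartan_cochain G Q) :
  inv_poly_form aQ p q alpha -> inv_poly_form aP p q (val_pull f alpha).
Proof.
move=> [pf inv]; split; first exact: val_pull_poly_form.
by move=> g x; rewrite /val_pull (pull_act _ _ sf ef) inv.
Qed.

Lemma val_pull_cartan_deg k (alpha : cartan_cochain G Q) :
  cartan_deg aQ k alpha -> cartan_deg aP k (val_pull f alpha).
Proof.
move=> [c [ic ->]]; exists (fun p => val_pull f (c p)); split.
  by move=> p pk; exact: val_pull_inv_poly_form (ic p pk).
by elim/big_rec2 : _ => // p u v _ <-.
Qed.

Lemma pull_contract_fund x (w : dform Q) :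
  pull f (contract (fund aQ x) w) = contract (fund aP x) (pull f w).
Proof. by apply: pull_contract => p; exact: fund_related. Qed.

Lemma val_pull_cartan_d k (alpha : cartan_cochain G Q) :
  cartan_deg aQ k alpha ->
  cartan_d aP (val_pull f alpha) = val_pull f (cartan_d aQ alpha).
Proof.
move=> ca; apply/funext => x; rewrite /cartan_d /val_pull.
rewrite -(pull_ext_d sf (cartan_deg_mixed x ca)) -pull_contract_fund.
by [].
Qed.

Lemma val_pull_CE_deg k (c : CE_cochain G Q) :
  CE_deg k c -> CE_deg k (val_pull f c).
Proof.
move=> [[cl c0] oc]; split.
  split=> [s1 s2 a u v|s1 s2 s3 u]; first by rewrite /val_pull cl.
  by rewrite /val_pull c0.
move=> xs; have := oc xs; case: ifP => _; first exact: Omega_pull.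
by rewrite /val_pull => ->.
Qed.

Lemma val_pull_CE_d k (c : CE_cochain G Q) :
  CE_deg k c -> CE_d (val_pull f c) = val_pull f (CE_d c).
Proof.
move=> [_ oc]; apply/funext => xs; rewrite /CE_d /val_pull.
rewrite (delta_CE_map (f := pull f)) // -(pull_ext_d sf) //.
by have := oc xs; case: ifP => _ => [/Omega_mixed //|->]; exact: mixed_form0.
Qed.

End pullback_one.

Lemma CE_d0 (R : realType) (G : lieGroup R) (P : manifold R) :
  CE_d (0 : CE_cochain G P) = 0.
Proof.
apply/funext => xs; rewrite /CE_d ext_d0 scaler0 addr0 /delta_CE.
by rewrite big1 // => j _; rewrite big1 // => i _; rewrite scaler0.
Qed.

Lemma cartan_d0 (R : realType) (G : lieGroup R) (P : manifold R)
    (a : lie_action G P) : cartan_d a 0 = 0.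
Proof.
by apply/funext => x; rewrite /cartan_d ext_d0 sub0r; apply/oppr0.
Qed.

(** * Pullback along an equivariant map of pairs *)

Section pullback.
Context (R : realType) (G : lieGroup R) (N M N' M' : manifold R).
Context (aN : lie_action G N) (aM : lie_action G M).
Context (aN' : lie_action G N') (aM' : lie_action G M').
Context (F : M -> N) (F' : M' -> N') (phiN : N' -> N) (phiM : M' -> M).
Hypotheses (F_smooth : smooth F) (F'_smooth : smooth F').
Hypotheses (phiN_smooth : smooth phiN) (phiM_smooth : smooth phiM).
Hypotheses (phiN_equiv : equivariant aN' aN phiN).
Hypotheses (phiM_equiv : equivariant aM' aM phiM).
Hypothesis (phi_comm : forall p, F (phiM p) = phiN (F' p)).

Lemma rpull_cochain_map :
  cochain_map (@rOmega R N M) (rext_d F) (@rOmega R N' M') (rext_d F')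
    (rpull phiN phiM).
Proof.
apply: cone_cochain_map.
- by [].
- by [].
- by move=> k u; exact: Omega_pull.
- by move=> k u; exact: Omega_pull.
- by move=> k u /Omega_mixed mu; rewrite pull_ext_d.
- by move=> k u /Omega_mixed mu; rewrite pull_ext_d.
- exact: ext_d0.
- exact: ext_d0.
- by move=> u; exact: pull_pull_comm.
Qed.

Lemma rpull_rcontract x w :
  rpull phiN phiM (rcontract (rfund aN aM x) w) =
  rcontract (rfund aN' aM' x) (rpull phiN phiM w).
Proof.
rewrite /rpull /rcontract /=.
rewrite -(pull_contract_fund phiN_smooth phiN_equiv).
by rewrite -(pull_contract_fund phiM_smooth phiM_equiv).
Qed.

Lemma rpull_rlie_der k x w : rOmega k w ->
  rpull phiN phiM (rlie_der (rfund aN aM x) w) =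
  rlie_der (rfund aN' aM' x) (rpull phiN phiM w).
Proof.
move=> [om1 om2]; rewrite /rpull /rlie_der /=.
have m2 : mixed_form w.2.
  by case: k om2 {om1} => [->|k /Omega_mixed //]; exact: mixed_form0.
by rewrite (pull_lie_der (fun p => fund_related x p phiN_smooth phiN_equiv)
    phiN_smooth (Omega_mixed om1) (fund_vf_diff_at aN x) (fund_vf_diff_at aN' x))
  (pull_lie_der (fun p => fund_related x p phiM_smooth phiM_equiv)
    phiM_smooth m2 (fund_vf_diff_at aM x) (fund_vf_diff_at aM' x)).
Qed.

Lemma rval_pull_CE_cochain_map :
  cochain_map (@rCE_deg R G N M) (rCE_d F) (@rCE_deg R G N' M') (rCE_d F')
    (rval_pull phiN phiM).
Proof.
apply: cone_cochain_map.
- by [].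
- by [].
- by move=> k u; exact: val_pull_CE_deg.
- by move=> k u; exact: val_pull_CE_deg.
- by move=> k u; exact: val_pull_CE_d.
- by move=> k u; exact: val_pull_CE_d.
- exact: CE_d0.
- exact: CE_d0.
- by move=> u; apply/funext => x; exact: pull_pull_comm.
Qed.

Lemma rval_pull_cartan_cochain_map :
  cochain_map (rcartan_deg aN aM) (rcartan_d aN aM F)
    (rcartan_deg aN' aM') (rcartan_d aN' aM' F') (rval_pull phiN phiM).
Proof.
apply: cone_cochain_map.
- by [].
- by [].
- by move=> k u; exact: val_pull_cartan_deg.
- by move=> k u; exact: val_pull_cartan_deg.
- by move=> k u; exact: val_pull_cartan_d.
- by move=> k u; exact: val_pull_cartan_d.
- exact: cartan_d0.
- exact: cartan_d0.
- by move=> u; apply/funext => x; exact: pull_pull_comm.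
Qed.

Lemma rpull_pre_plectic n w :
  pre_plectic F n w -> pre_plectic F' n (rpull phiN phiM w).
Proof.
have [oR _ dR] := rpull_cochain_map n.+1.
by move=> [ow dw]; split; [exact: oR|rewrite dR // dw].
Qed.

Lemma rpull_rinvariant w :
  rinvariant aN aM w -> rinvariant aN' aM' (rpull phiN phiM w).
Proof.
move=> iw g; rewrite -[in RHS](iw g) /rpull /=.
by rewrite (pull_act _ _ phiN_smooth phiN_equiv) (pull_act _ _ phiM_smooth phiM_equiv).
Qed.

Lemma rval_pull_rinv_poly_form i q (P : rcartan G N M) :
  rinv_poly_form aN aM i q P -> rinv_poly_form aN' aM' i q (rval_pull phiN phiM P).
Proof.
move=> [P1 P2]; split; first exact: val_pull_inv_poly_form P1.
case: q P2 {P1} => [|q] /=; first by move=> ->.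
exact: val_pull_inv_poly_form.
Qed.

(** The components are pulled back together with the cocycle, so the result serves arbitrary and
    one-step extensions alike. *)
Lemma extension_by_pull n w (P : nat -> rcartan G N M) wG :
  extension_by aN aM F n w P wG ->
  extension_by aN' aM' F' n (rpull phiN phiM w)
    (fun i => rval_pull phiN phiM (P i)) (rval_pull phiN phiM wG).
Proof.
have [oR _ dR] := rval_pull_cartan_cochain_map n.+1.
move=> [PP EG oG dG]; split.
- move=> i i1; have := PP i i1; case: ifP => _; last by move=> ->.
  exact: rval_pull_rinv_poly_form.
- rewrite EG; have -> : rval_pull phiN phiM (rconst G w - \sum_(1 <= i < n.+2) P i) =
      rconst G (rpull phiN phiM w) -
      rval_pull phiN phiM (\sum_(1 <= i < n.+2) P i) by [].
  by congr (_ - _); elim/big_rec2 : _ => // i u v _ <-.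
- exact: oR.
- by rewrite dR // dG.
Qed.

Lemma one_step_extension_pull n w mu : one_step_extension aN aM F n w mu ->
  one_step_extension aN' aM' F' n (rpull phiN phiM w) (rval_pull phiN phiM mu).
Proof.
move=> /extension_by_pull; rewrite /one_step_extension.
(* The pullback of 0 is 0, so a family concentrated at index 1 stays so. *)
by congr extension_by; apply/funext => i; case: ifP.
Qed.

Lemma rpull_rcontracts xs w :
  rpull phiN phiM (rcontracts aN aM xs w) =
  rcontracts aN' aM' xs (rpull phiN phiM w).
Proof.
elim: xs w => [//|x xs IH] w; rewrite [LHS]IH rpull_rcontract.
by [].
Qed.

(** Stated for every list, both sides being 0 outside lengths 1 to n; the two maps thus agree as
    functions, and a property of one can be rewritten into a property of the other. *)
Lemma induced_moment_map_pull n mu xs :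
  induced_moment_map aN' aM' n (rval_pull phiN phiM mu) xs =
  rpull phiN phiM (induced_moment_map aN aM n mu xs).
Proof.
case: xs => // x s; rewrite /induced_moment_map; case: ifP => // _.
by rewrite -[X in rcontracts _ _ _ X]/(rpull phiN phiM (_, _)) -rpull_rcontracts.
Qed.

(** Pullback is applied to the defining identities: it passes through the bracket sum by linearity,
    through [rext_d] as a cochain map, and through the contractions because the fundamental fields
    are related. *)
Lemma homotopy_moment_map_pull n w f :
  homotopy_moment_map aN aM F n w f ->
  homotopy_moment_map aN' aM' F' n (rpull phiN phiM w)
    (fun xs => rpull phiN phiM (f xs)).
Proof.
move=> [f0 [fl fa] oF fd]; split.
- by move=> xs /f0 ->.
- split=> [s1 s2 a u v|s1 s2 s3 u]; last by rewrite fa.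
  exact: etrans (congr1 _ (fl s1 s2 a u v)) (rpull_linear _ _ _ _ _).
- by move=> xs xn; have [oR _ _] := rpull_cochain_map (n - size xs)%N; exact/oR/oF.
- move=> xs xn; have := congr1 (rpull phiN phiM) (fd xs xn).
  rewrite rpullN [X in _ = rpull _ _ X]addrC rpull_linear [X in _ = X]addrC.
  rewrite (delta_CE_map _ _ (rpull_linear phiN phiM)) => ->.
  rewrite -rpull_rcontracts.
  have -> : rext_d F' (rpull phiN phiM (f xs)) = rpull phiN phiM (rext_d F (f xs)).
    have [xn'|xn'] := leqP (size xs) n.
      have [_ _ dR] := rpull_cochain_map (n - size xs)%N.
      by apply: dR; apply: oF; rewrite xn'; case/andP: xn => ->.
    rewrite f0; last by rewrite (leqNgt (size xs) n) xn' andbF.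
    rewrite /rext_d /cone_d /rpull /= -[pull _ 0]/(0 : dform _).
    by rewrite -[pull _ 0]/(0 : dform _) !ext_d0.
  by [].
Qed.

End pullback.

Theorem proposition10p2 (R : realType) (G : lieGroup R)
  (N M N' M' : manifold R)
  (aN : lie_action G N) (aM : lie_action G M)
  (aN' : lie_action G N') (aM' : lie_action G M')
  (F : M -> N) (F' : M' -> N') (phiN : N' -> N) (phiM : M' -> M)
  (F_smooth : smooth F) (F'_smooth : smooth F')
  (phiN_smooth : smooth phiN) (phiM_smooth : smooth phiM)
  (F_equiv : equivariant aM aN F) (F'_equiv : equivariant aM' aN' F')
  (phiN_equiv : equivariant aN' aN phiN)
  (phiM_equiv : equivariant aM' aM phiM)
  (phi_comm : forall p, F (phiM p) = phiN (F' p)) :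
  (* (i) *)
  (cochain_map (@rOmega R N M) (rext_d F) (@rOmega R N' M') (rext_d F')
     (rpull phiN phiM)
   /\
   forall (k : nat) (w : rform N M) (x : lieAlg G), rOmega k w ->
     rpull phiN phiM (rcontract (rfund aN aM x) w)
       = rcontract (rfund aN' aM' x) (rpull phiN phiM w)
     /\
     rpull phiN phiM (rlie_der (rfund aN aM x) w)
       = rlie_der (rfund aN' aM' x) (rpull phiN phiM w))
  /\
  (* (ii) *)
  [/\ cochain_map (@rCE_deg R G N M) (rCE_d F) (@rCE_deg R G N' M') (rCE_d F')
        (rval_pull phiN phiM),
      cochain_map (rcartan_deg aN aM) (rcartan_d aN aM F)
        (rcartan_deg aN' aM') (rcartan_d aN' aM' F') (rval_pull phiN phiM)
    & forall (n : nat) (w : rform N M), (1 <= n)%N ->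
        pre_plectic F n w -> rinvariant aN aM w ->
        [/\ pre_plectic F' n (rpull phiN phiM w),
            rinvariant aN' aM' (rpull phiN phiM w)
          & forall wG, extension aN aM F n w wG ->
              extension aN' aM' F' n (rpull phiN phiM w)
                (rval_pull phiN phiM wG)]]
  /\
  (* (iii) *)
  forall (n : nat) (w : rform N M) (mu : rcartan G N M), (1 <= n)%N ->
    pre_plectic F n w -> rinvariant aN aM w ->
    one_step_extension aN aM F n w mu ->
    let f := induced_moment_map aN aM n mu in
    let f' := induced_moment_map aN' aM' n (rval_pull phiN phiM mu) in
    [/\ one_step_extension aN' aM' F' n (rpull phiN phiM w)
          (rval_pull phiN phiM mu),
        homotopy_moment_map aN aM F n w f ->
          homotopy_moment_map aN' aM' F' n (rpull phiN phiM w) f'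
      & forall xs, (1 <= size xs <= n)%N ->
          f' xs = rpull phiN phiM (f xs)].
Proof.
split; [split|split].
- exact: rpull_cochain_map.
- move=> k w x ow; split; first exact: rpull_rcontract.
  exact: rpull_rlie_der ow.
- split=> [||n w n1 pw iw].
  + exact: rval_pull_CE_cochain_map.
  + exact: rval_pull_cartan_cochain_map.
  + split; [exact: rpull_pre_plectic pw|exact: rpull_rinvariant iw|].
    move=> wG [P eP]; exists (fun i => rval_pull phiN phiM (P i)).
    exact: extension_by_pull eP.
- move=> n w mu n1 pw iw ow f f'.
  have E : f' = fun xs => rpull phiN phiM (f xs).
    by apply/funext => xs; exact: induced_moment_map_pull.
  split; [exact: one_step_extension_pull ow| |by rewrite E].
  by rewrite E; exact: homotopy_moment_map_pull.
Qed.
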